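(* Assume $\Omega=(a,b)\subset\mathbb{R}$, $V=H_0^1(a,b)$, and $$a(u,v):=\int_a^b\kappa(x)u'(x)v'(x)+c(x)u(x)v(x)\,dx,$$ where $\kappa\in L^\infty(a,b)$ is piecewise constant on the mesh $\mathcal T_h$, with $\kappa|_K=\kappa_K>0$ for every $K\in\mathcal T_h$, and $c\in L^\infty(a,b)$ satisfies $c\ge0$. Let $u^\star\in V$ solve $a(u^\star,v)=\int_a^bf(x)v(x)\,dx$ for all $v\in V$, with $f\in L^2(a,b)$. Let $u_h^{\mathrm{FE}}\in V_h$ be the conforming $P_1$ Galerkin solution satisfying $a(u_h^{\mathrm{FE}},v_h)=\int_a^bf(x)v_h(x)\,dx$ for all $v_h\in V_h$. For each element $K\in\mathcal T_h$, write $h_K:=|K|$ and define $R_K:=f-c\,u_h^{\mathrm{FE}}$ on $K$, $$\eta_{K,h}^{\mathrm{tr}}:=\frac{h_K}{\pi\sqrt{\kappa_K}}\|R_K\|_{L^2(K)},\qquad \eta_h^{\mathrm{tr}}:=\Bigl(\sum_{K\in\mathcal T_h}(\eta_{K,h}^{\mathrm{tr}})^2\Bigr)^{1/2}.$$ Then $$\|u^\star-u_h^{\mathrm{FE}}\|_a\le\eta_h^{\mathrm{tr}},\qquad \|v\|_a:=a(v,v)^{1/2}.$$ Moreover, for every query point $x_i\in[a,b]$, the constant $$C_{i,h}^{\mathrm{pt}}:=\min\left\{\left(\int_a^{x_i}\kappa(x)^{-1}\,dx\right)^{1/2},\left(\int_{x_i}^b\kappa(x)^{-1}\,dx\right)^{1/2}\right\}$$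 satisfies $$|u^\star(x_i)-u_h^{\mathrm{FE}}(x_i)|\le C_{i,h}^{\mathrm{pt}}\,\eta_h^{\mathrm{tr}}.$$ Furthermore, one may take the comparison vector, the consistency bound and the evaluation bound as $$U_h^\pi=U_h^{\mathrm{FE}}=U_h^\star,\qquad T_h=0,\qquad \varepsilon_{i,h}^{\mathrm{eval}}=C_{i,h}^{\mathrm{pt}}\,\eta_h^{\mathrm{tr}},$$ that is, $U_h^{\mathrm{FE}}=U_h^\star$, and with $U_h^\pi:=U_h^{\mathrm{FE}}$ the inequalities $\|A_hU_h^\pi-b_h\|_{W_h}\le T_h$ and $|\ell_{i,h}^\top U_h^\pi-u^\star(x_i)|\le\varepsilon_{i,h}^{\mathrm{eval}}$ hold for these values of $T_h$ and $\varepsilon_{i,h}^{\mathrm{eval}}$. Consequently, $$u^\star(x_i)\in\left[c_{i,h}^{\mathrm{corr}}-C_{i,h}^{\mathrm{pt}}\,\eta_h^{\mathrm{tr}},\;c_{i,h}^{\mathrm{corr}}+C_{i,h}^{\mathrm{pt}}\,\eta_h^{\mathrm{tr}}\right].$$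
   Context: $\mathcal T_h$ is a finite mesh of $[a,b]$ into intervals, and $V_h\subset H_0^1(a,b)$ is the space of continuous functions that are affine on each $K\in\mathcal T_h$ and vanish at $a$ and $b$. Let $\phi_1,\dots,\phi_{N_h}$ be the $P_1$ nodal (hat) basis on the mesh, $\mathcal I_hU:=\sum_jU_j\phi_j$ for $U\in\mathbb{R}^{N_h}$, and $\ell_{i,h}:=(\phi_1(x_i),\dots,\phi_{N_h}(x_i))^\top$, so $\ell_{i,h}^\top U=(\mathcal I_hU)(x_i)$. The coefficient vectors of $V_h$ form the admissible affine set $U_{0,h}+Z_h\mathbb{R}^{n_h}$ with $Z_h\in\mathbb{R}^{N_h\times n_h}$ of full column rank, and $A_h\in\mathbb{R}^{M_h\times N_h}$, $b_h\in\mathbb{R}^{M_h}$, $M_h=n_h$, are such that the reduced system $\widehat A_hy=\widehat b_h$, with $\widehat A_h:=A_hZ_h$, $\widehat b_h:=b_h-A_hU_{0,h}$, is the Galerkin system after elimination of the Dirichlet constraints (i.e. $y$ solves it iff $\mathcal I_h(U_{0,h}+Z_hy)$ satisfies the Galerkin equations); $\widehat A_h$ is symmetric positive definite. $U_h^{\mathrm{FE}}=U_{0,h}+Z_hy_h^{\mathrm{FE}}$ is the coefficient vector of $u_h^{\mathrm{FE}}$. The discrete target is $U_h^\star:=U_{0,h}+Z_h\widehat A_h^{-1}\widehat b_h$. $W_h\in\mathbb{R}^{M_h\times M_h}$ is symmetric positive definite, $\|r\|_{W_h}:=(r^\top W_hr)^{1/2}$, $\widehat H_h:=\widehat A_h^\top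 W_h\widehat A_h$. $U_\theta=U_{0,h}+Z_hy_\theta$ is an arbitrary admissible vector, $r_h:=A_hU_\theta-b_h$, $q_{i,h}$ solves $\widehat H_hq_{i,h}=Z_h^\top\ell_{i,h}$, $g_{i,h}:=W_h\widehat A_hq_{i,h}$, and $c_{i,h}^{\mathrm{corr}}:=\ell_{i,h}^\top U_\theta-g_{i,h}^\top r_h$. Point values of $H^1(a,b)$ functions are those of the continuous representative. *)

(* Defs.v *)
From mathcomp Require Import all_boot all_order all_algebra.
From mathcomp Require Import all_classical all_reals all_analysis.

Set Implicit Arguments.
Unset Strict Implicit.
Unset Printing Implicit Defensive.

Import Order.TTheory GRing.Theory Num.Theory.
Import numFieldNormedType.Exports.

Local Open Scope classical_set_scope.
Local Open Scope ring_scope.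

Section Lebesgue_spaces.
Variable R : realType.
Implicit Types (A : set R) (f : R -> R).

(* Functions on A are represented by total functions; their values outside A
   are irrelevant because of the restriction [f \_ A], which is 0 off A. *)
Definition Lp A (p : \bar R) f : Prop :=
  (f \_ A) \in Lfun (@lebesgue_measure R) p.

Definition L2norm A f : R :=
  fine ('N[@lebesgue_measure R]_2%:E [EFin \o (f \_ A)]).

End Lebesgue_spaces.

Section Sobolev.
Variables (R : realType) (a b : R).
Implicit Types (u v g phi : R -> R).

Let mu := @lebesgue_measure R.

Definition test_function phi : Prop :=
  [/\ forall n x, derivable (derive1n n phi) x 1,
      compact (closure [set x | phi x != 0]) &
      closure [set x | phi x != 0] `<=` `]a, b[ ].

Definition is_weak_derivative u g : Prop :=
  forall phi, test_function phi ->
    \int[mu]_(x in `]a, b[) (u x * derive1 phi x)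
    = - \int[mu]_(x in `]a, b[) (g x * phi x).

(* A choice of an L^2 weak derivative; it is unique up to a null set when it
   exists, and is the zero function (a meaningless default) otherwise. *)
Definition wderiv u : R -> R :=
  xget (cst 0) [set g | Lp `]a, b[ 2%:E g /\ is_weak_derivative u g].

Definition H1 u : Prop :=
  Lp `]a, b[ 2%:E u /\
  exists g, Lp `]a, b[ 2%:E g /\ is_weak_derivative u g.

Definition H1norm u : R :=
  Num.sqrt (L2norm `]a, b[ u ^+ 2 + L2norm `]a, b[ (wderiv u) ^+ 2).

(* The closure of the test functions in H^1(a, b). *)
Definition H10 u : Prop :=
  H1 u /\
  forall e : R, 0 < e -> exists2 phi, test_function phi & H1norm (u \- phi) < e.

(* The continuous representative on [a, b] of the class of u; it is unique
   on [a, b] when a < b, and exists whenever u is in H^1(a, b). *)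
Definition cont_rep u : R -> R :=
  xget (cst 0) [set w | {within `[a, b], continuous w} /\
    {ae mu, forall x, x \in `]a, b[ -> w x = u x}].

Definition aform (kappa c u v : R -> R) : R :=
  \int[mu]_(x in `]a, b[)
    (kappa x * wderiv u x * wderiv v x + c x * u x * v x).

Definition energy_norm (kappa c v : R -> R) : R :=
  Num.sqrt (aform kappa c v v).

Definition load (f v : R -> R) : R := \int[mu]_(x in `]a, b[) (f x * v x).

End Sobolev.

Section P1_elements.
Variables (R : realType) (a b : R) (s : seq R).
(* Under [itv_partition a b s] the mesh nodes are a :: s, and the elements are
   indexed by k < size s. *)

Definition node (j : nat) : R := nth b (a :: s) j.

Definition element (k : nat) : set R := `[node k, node k.+1]%classic.

Definition element_size (k : nat) : R := node k.+1 - node k.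

Definition Vh (v : R -> R) : Prop :=
  [/\ {within `[a, b], continuous v},
      forall k, (k < size s)%N ->
        exists m d : R, forall x, element k x -> v x = m * x + d,
      v a = 0 & v b = 0].

(* At the two boundary nodes one of the open intervals below is empty, because
   0.-1 = 0 and node (size s).+1 = b = node (size s). *)
Definition hat (j : nat) (x : R) : R :=
  if x == node j then 1
  else if node j.-1 < x < node j then
    (x - node j.-1) / (node j - node j.-1)
  else if node j < x < node j.+1 then
    (node j.+1 - x) / (node j.+1 - node j)
  else 0.

(* All nodes, including a and b, carry a coefficient: the Dirichlet conditions
   are imposed on coefficient vectors and not by dropping basis functions. *)
Definition Ih (U : 'cV[R]_(size s).+1) (x : R) : R := \sum_j U j 0 * hat j x.

Definition evalvec (x : R) : 'cV[R]_(size s).+1 := \col_j hat j x.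

Definition eta_elt (kappaK : 'I_(size s) -> R) (c f uFE : R -> R)
    (k : 'I_(size s)) : R :=
  element_size k / (pi * Num.sqrt (kappaK k))
  * L2norm (element k) (fun x => f x - c x * uFE x).

Definition eta (kappaK : 'I_(size s) -> R) (c f uFE : R -> R) : R :=
  Num.sqrt (\sum_(k < size s) eta_elt kappaK c f uFE k ^+ 2).

End P1_elements.

Definition Cpt (R : realType) (a b : R) (kappa : R -> R) (x : R) : R :=
  Num.min
    (Num.sqrt (\int[@lebesgue_measure R]_(t in `[a, x]) (kappa t)^-1))
    (Num.sqrt (\int[@lebesgue_measure R]_(t in `[x, b]) (kappa t)^-1)).

Definition spd (R : realType) (n : nat) (M : 'M[R]_n) : Prop :=
  M^T = M /\ forall y : 'cV[R]_n, y != 0 -> 0 < (y^T *m M *m y) 0 0.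

Definition wnorm (R : realType) (n : nat) (W : 'M[R]_n) (r : 'cV[R]_n) : R :=
  Num.sqrt ((r^T *m W *m r) 0 0).

(* Main.v *)
Require Import Defs.
From mathcomp Require Import all_boot all_order all_algebra.
From mathcomp Require Import all_classical all_reals all_analysis.
From mathcomp Require Import measurable_realfun ess_sup_inf.
From mathcomp Require Import ring lra.
Set Implicit Arguments.
Unset Strict Implicit.
Unset Printing Implicit Defensive.
Import Order.TTheory GRing.Theory Num.Theory.
Import numFieldNormedType.Exports.
Local Open Scope classical_set_scope.
Local Open Scope ring_scope.

(** Write e = u* - u_h and A(e, e) for its squared energy norm.  For a test
    function phi with nodal interpolant I phi, Galerkin orthogonality gives
    A(e, phi) = int (f - c u_h) (phi - I phi), because kappa u_h' is constant on
    each element K while phi - I phi vanishes at the nodes.  The Poincare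
    inequality with the sharp constant h_K / pi for functions vanishing at both
    ends of K and the inequality 2xy <= x^2 + y^2 then yield
    2 A(e, phi) <= eta^2 + A(phi, phi), that is
    A(e, e) <= eta^2 + A(e - phi, e - phi); letting phi tend to e gives the energy
    estimate.  The pointwise estimate follows from the Cauchy-Schwarz inequality
    with weight kappa applied to e(x) = int_a^x e' = - int_x^b e'.

    An element u of H^1_0 is handled through the relation [test_approx u g]: there
    are test functions phi with phi -> u and phi' -> g in L^2.  It makes g the
    weak derivative of u and [x |-> int_a^x g] the continuous representative. *)

(** * Square-integrable functions *)

(** The sharp Poincare inequality is proved for C^1 functions only, which is why the residual is
    tested against test functions phi and never against the error e itself; passing from phi to e
    then needs only that the form A is bounded. [wderiv] and [cont_rep] are choices, so nothing can
    be computed with them until a candidate is exhibited and shown to be unique, up to a null set or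
    on [a, b]. Uniqueness of weak derivatives is the fundamental lemma of the calculus of
    variations, for which test functions are built explicitly from exp(-1/x). The error e = u* - u_h
    can be approximated by test functions only if V_h lies in H^1_0; this amounts to approximating
    step functions of mean zero by derivatives of test functions. The final enclosure is algebraic:
    the correction g^T r cancels exactly the deviation of U_theta from the Galerkin vector, so the
    corrected value is u_h(x) whatever U_theta is. *)

Section L2_theory.
Context d (T : measurableType d) (R : realType).
Context (mu : {measure set T -> \bar R}).
Implicit Types (A B : set T) (f g c : T -> R).

(** Phrased with a plain integral rather than a norm, so that squares of sums expand by linearity;
    [Lfun2_restrictP] translates from [Lp]. *)
Definition L2on A f : Prop :=
  measurable_fun A f /\ mu.-integrable A (EFin \o (fun x => f x ^+ 2)).

Lemma L2on_sub A B f : measurable A -> measurable B -> B `<=` A ->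
  L2on A f -> L2on B f.
Proof.
move=> mA mB BA [mf fi]; split; first exact: measurable_funS mf.
exact: integrableS fi.
Qed.

Lemma L2on_mul_integrable A f g : measurable A -> L2on A f -> L2on A g ->
  mu.-integrable A (EFin \o (fun x => f x * g x)).
Proof.
move=> mA [mf fi] [mg gi].
apply: (@le_integrable _ _ _ mu A _ _
    (EFin \o (fun x => f x ^+ 2 + g x ^+ 2))) => //.
- by apply/measurable_EFinP; exact: measurable_funM.
- move=> x Ax /=; rewrite lee_fin normrM.
  rewrite [leRHS]ger0_norm ?addr_ge0 ?sqr_ge0//.
  rewrite -(real_normK (num_real (f x))) -(real_normK (num_real (g x))).
  have := sqr_ge0 (`|f x| - `|g x|); have := sqr_ge0 (`|f x| + `|g x|); nra.
- by move: (integrableD mA fi gi).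
Qed.

Lemma L2onD A f g : measurable A -> L2on A f -> L2on A g ->
  L2on A (fun x => f x + g x).
Proof.
move=> mA Lf Lg; have fgi := L2on_mul_integrable mA Lf Lg.
case: Lf Lg => mf fi [mg gi]; split; first exact: measurable_funD.
have := integrableD mA (integrableD mA fi gi) (integrableZl mA 2 fgi).
apply: eq_integrable => // x _ /=; rewrite -EFinM -!EFinD; congr (_%:E).
by ring.
Qed.

Lemma L2onZ A k f : measurable A -> L2on A f -> L2on A (fun x => k * f x).
Proof.
move=> mA [mf fi]; split; first exact: measurable_funM.
have := integrableZl mA (k ^+ 2) fi.
by apply: eq_integrable => // x _ /=; rewrite -EFinM exprMn.
Qed.

Lemma L2onB A f g : measurable A -> L2on A f -> L2on A g ->
  L2on A (fun x => f x - g x).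
Proof.
move=> mA Lf Lg; have := L2onD mA Lf (L2onZ (-1) mA Lg).
by under eq_fun do rewrite mulN1r.
Qed.

Lemma L2on_bounded A (M : R) c : measurable A -> (mu A < +oo)%E ->
  measurable_fun A c -> {ae mu, forall x, A x -> `|c x| <= M} -> L2on A c.
Proof.
move=> mA Afin mc cM; split => //.
have mc2 : measurable_fun A (EFin \o (fun x => c x ^+ 2)).
  by apply/measurable_EFinP; exact: measurable_funX.
apply/integrableP; split => //.
apply: (@le_lt_trans _ _ (\int[mu]_(x in A) (cst (M ^+ 2)%:E x))%E).
  apply: ae_ge0_le_integral => //; first exact: measurableT_comp.
  - by move=> x _; rewrite lee_fin sqr_ge0.
  apply: filterS cM => x /= h Ax; rewrite lee_fin ger0_norm ?sqr_ge0//.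
  rewrite -(real_normK (num_real (c x))).
  by have := h Ax; have := normr_ge0 (c x); nra.
rewrite integral_cst// lte_mul_pinfty// lee_fin sqr_ge0//.
Qed.

Lemma L2on_bounded_mul A (M : R) c f : measurable A ->
  measurable_fun A c -> {ae mu, forall x, A x -> `|c x| <= M} ->
  L2on A f -> L2on A (fun x => c x * f x).
Proof.
move=> mA mc cM [mf fi]; have mcf : measurable_fun A (fun x => c x * f x).
  exact: measurable_funM.
split => //.
have mc2 : measurable_fun A (EFin \o (fun x => (c x * f x) ^+ 2)).
  by apply/measurable_EFinP; exact: measurable_funX.
have /integrableP[mf2 fi2] := integrableZl mA (M ^+ 2) fi.
apply/integrableP; split => //; apply: le_lt_trans fi2.
apply: ae_ge0_le_integral => //; try exact: measurableT_comp.
apply: filterS cM => x /= h Ax; rewrite lee_fin !ger0_norm ?sqr_ge0//; last first.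
  by rewrite mulr_ge0// sqr_ge0.
rewrite exprMn ler_wpM2r ?sqr_ge0// -(real_normK (num_real (c x))).
by have := h Ax; have := normr_ge0 (c x); nra.
Qed.

Lemma Rintegral_sqr_ge0 A f : 0 <= \int[mu]_(x in A) (f x ^+ 2).
Proof. by apply: Rintegral_ge0 => x _; exact: sqr_ge0. Qed.

(** The left side is nonnegative for every t. Cauchy-Schwarz, the bound on the square of a sum and
    the weighted Young inequality of [residual_element] all come from a choice of t here. *)
Lemma Rintegral_sqrD A f g (t : R) : measurable A -> L2on A f -> L2on A g ->
  \int[mu]_(x in A) ((f x + t * g x) ^+ 2) =
  \int[mu]_(x in A) (f x ^+ 2) + 2 * t * \int[mu]_(x in A) (f x * g x)
  + t ^+ 2 * \int[mu]_(x in A) (g x ^+ 2).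
Proof.
move=> mA Lf Lg; have fgi := L2on_mul_integrable mA Lf Lg.
have [_ fi] := Lf; have [_ gi] := Lg.
have i1 : mu.-integrable A (EFin \o (fun x => 2 * t * (f x * g x))).
  by have := integrableZl mA (2 * t) fgi.
have i2 : mu.-integrable A (EFin \o (fun x => t ^+ 2 * g x ^+ 2)).
  by have := integrableZl mA (t ^+ 2) gi.
have i3 : mu.-integrable A (EFin \o (fun x => f x ^+ 2 + 2 * t * (f x * g x))).
  by have := integrableD mA fi i1.
rewrite -(RintegralZl (2 * t) mA fgi) -(RintegralZl (t ^+ 2) mA gi).
rewrite -(RintegralD mA fi i1) -(RintegralD mA i3 i2).
by apply: eq_Rintegral => x _; ring.
Qed.

(** A quadratic without sign change has nonpositive discriminant; the degenerate case q = 0 is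
    included. *)
Lemma sqr_le_mul_of_quadratic_ge0 (p q r : R) :
  (forall t, 0 <= p + 2 * t * r + t ^+ 2 * q) -> 0 <= q -> r ^+ 2 <= p * q.
Proof.
move=> H; rewrite le_eqVlt => /predU1P[q0|q0].
  rewrite -q0 mulr0; have [->|r0] := eqVneq r 0; first by rewrite expr0n.
  (* With q = 0 the expression is affine in t, and this t gives it the value -1. *)
  have := H (- (p + 1) / (2 * r)).
  rewrite -q0 mulr0 addr0 (_ : 2 * _ * r = - (p + 1)); last by field.
  by rewrite opprD addNKr oppr_ge0 ler10.
(* The minimiser in t. *)
have := H (- (r / q)).
rewrite (_ : p + _ + _ = (p * q - r ^+ 2) / q); last by field; rewrite gt_eqF.
by rewrite pmulr_lge0 ?invr_gt0// subr_ge0.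
Qed.

Lemma cauchy_schwarz_sqr A f g : measurable A -> L2on A f -> L2on A g ->
  (\int[mu]_(x in A) (f x * g x)) ^+ 2 <=
  \int[mu]_(x in A) (f x ^+ 2) * \int[mu]_(x in A) (g x ^+ 2).
Proof.
move=> mA Lf Lg; apply: sqr_le_mul_of_quadratic_ge0 => [t|].
  by rewrite -Rintegral_sqrD//; exact: Rintegral_sqr_ge0.
exact: Rintegral_sqr_ge0.
Qed.

End L2_theory.

(** * Translation between Lebesgue norms and integrals *)

Section Lp_facts.
Context d (T : measurableType d) (R : realType).
Context (mu : {measure set T -> \bar R}).
Implicit Types (A B : set T) (f g c : T -> R).

Lemma Lfun2_restrictP A f : measurable A ->
  f \_ A \in Lfun mu 2%:E <-> L2on mu A f.
Proof.
move=> mA; split.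
- move=> /[dup] /Lfun2_integrable_sqr fi.
  rewrite inE => /andP[/[!inE]/= mf _]; split.
    exact/(measurable_restrictT _ mA).
  apply/integrable_mkcond => //; apply: eq_integrable fi => // x _ /=.
  by rewrite !patchE; case: ifP => //; rewrite expr0n.
- move=> [mf fi]; rewrite inE; apply/andP; rewrite !inE/=; split.
    exact/(measurable_restrictT _ mA).
  rewrite /finite_norm unlock; apply: poweR_lty.
  have /integrableP[_] := (integrable_mkcond _ mA).1 fi.
  apply: le_lt_trans; rewrite le_eqVlt; apply/orP; left; apply/eqP.
  apply: eq_integral => x _ /=; rewrite !patchE.
  have -> : (point : R) = 0 by [].
  case: ifP => _; last by rewrite normr0 powR0// abse0.
  by rewrite /= powR_mulrn// real_normK ?num_real// ger0_norm ?sqr_ge0.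
Qed.

Lemma fine_Lnorm2_sqr A f :
  fine ('N[mu]_2%:E [EFin \o (f \_ A)])%E ^+ 2 = \int[mu]_(x in A) (f x ^+ 2).
Proof.
rewrite -powR_mulrn ?fine_ge0 ?Lnorm_ge0// -fine_poweR powR_Lnorm//.
rewrite Rintegral_mkcond /Rintegral; congr fine; apply: eq_integral => x _ /=.
rewrite !patchE; have -> : (point : R) = 0 by [].
case: ifP => _; last by rewrite normr0 powR0.
by rewrite powR_mulrn// real_normK ?num_real.
Qed.

Lemma Lfuny_restrict_bounded A f : measurable A -> f \_ A \in Lfun mu +oo%E ->
  measurable_fun A f /\
  exists M, {ae mu, forall x, A x -> `|f x| <= M}.
Proof.
move=> mA; rewrite inE => /andP[/[!inE]/= mf]; rewrite /finite_norm unlock.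
split; first exact/(measurable_restrictT _ mA).
move: b; case: ifPn => [mu0 fy|]; last first.
  (* Here the whole space is null: the sup norm is a default value, and any bound holds off the null
     set [setT]. *)
  rewrite lt0e measure_ge0 andbT negbK => /eqP mu0 _.
  by exists 0; exists setT; split.
have [M HM] := ess_supr_bounded (f := Num.norm \o (f \_ A)) (mu := mu) fy.
exists M; apply: filterS HM => x /=; rewrite patchE => + Ax.
by rewrite mem_set.
Qed.

Lemma ae_eq_Rintegral A f g : measurable A ->
  measurable_fun A f -> measurable_fun A g ->
  {ae mu, forall x, A x -> f x = g x} ->
  \int[mu]_(x in A) f x = \int[mu]_(x in A) g x.
Proof.
move=> mA mf mg fg; congr fine; apply: ae_eq_integral => //.
- exact/measurable_EFinP.
- exact/measurable_EFinP.
- by apply: filterS fg => x /= h Ax; rewrite (h Ax).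
Qed.

Lemma ae_Rintegral_ge0 A f : measurable A -> measurable_fun A f ->
  {ae mu, forall x, A x -> 0 <= f x} -> 0 <= \int[mu]_(x in A) f x.
Proof.
move=> mA mf f0.
rewrite (@ae_eq_Rintegral A f (Num.norm \o f))//.
- by apply: Rintegral_ge0 => x _ /=.
- exact: measurableT_comp.
- by apply: filterS f0 => x /= h Ax; rewrite ger0_norm// h.
Qed.

Lemma ae_le_Rintegral A f g : measurable A ->
  mu.-integrable A (EFin \o f) -> mu.-integrable A (EFin \o g) ->
  {ae mu, forall x, A x -> f x <= g x} ->
  \int[mu]_(x in A) f x <= \int[mu]_(x in A) g x.
Proof.
move=> mA fi gi fg; rewrite -subr_ge0 -RintegralB//.
apply: ae_Rintegral_ge0 => //.
- apply: measurable_funB; apply/measurable_EFinP.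
    exact: measurable_int gi.
  exact: measurable_int fi.
- by apply: filterS fg => x /= h Ax; rewrite subr_ge0 h.
Qed.

End Lp_facts.

(** * Smooth functions and test functions *)

Section smooth_functions.
Context (R : realType).
Implicit Types (f g : R -> R) (p : {poly R}) (x : R).

Definition smooth f : Prop := forall n x, derivable (derive1n n f) x 1.

(** Coinduction for smoothness: iterated derivatives never leave a class stable under [derive1], so
    no formula for them is needed. *)
Lemma smooth_coind (S : (R -> R) -> Prop) :
  (forall f, S f -> (forall x, derivable f x 1) /\ S (derive1 f)) ->
  forall f, S f -> smooth f.
Proof.
move=> H f Sf n; suff : S (derive1n n f) by move=> /H[].
by elim: n => [//|n /H[_]].
Qed.

Lemma smooth_derivable f x : smooth f -> derivable f x 1.
Proof. by move=> /(_ 0%N x). Qed.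

Lemma smooth_derive1 f : smooth f -> smooth (derive1 f).
Proof. by move=> sf n x; have := sf n.+1 x; rewrite /derive1n iterSr. Qed.

Lemma derivable1_continuous f : (forall x, derivable f x 1) -> continuous f.
Proof.
by move=> df x; exact/differentiable_continuous/derivable1_diffP.
Qed.

Lemma smooth_continuous f : smooth f -> continuous f.
Proof. by move=> sf; apply: derivable1_continuous => x; exact: smooth_derivable. Qed.

Lemma is_derive1_funext f g : (forall x, is_derive x 1 f (g x)) ->
  derive1 f = g.
Proof. by move=> fg; apply/funext => x; rewrite derive1E; case: (fg x). Qed.

Lemma smooth_primitive f g : (forall x, is_derive x 1 f (g x)) -> smooth g ->
  smooth f.
Proof.
move=> fg sg [|n] x; first by case: (fg x).
by rewrite /derive1n iterSr (is_derive1_funext fg); exact: sg.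
Qed.

Lemma smooth_is_derive f x : smooth f -> is_derive x 1 f (derive1 f x).
Proof. by move=> sf; rewrite derive1E; exact/derivableP/smooth_derivable. Qed.

(** For p = 1 this is the classical exp(-1/x). The polynomial factor makes the family stable under
    derivation: p becomes X^2 (p - p'). *)
Definition flat p x : R := if 0 < x then p.[x^-1] * expR (- x^-1) else 0.

Lemma horner_le_expR p : exists2 C, 0 <= C &
  forall y, 1 <= y -> `|p.[y]| * expR (- y) <= C * y ^- 2.
Proof.
exists ((\sum_(i < size p) `|p`_i|) * ((size p).+2)`!%:R).
  by rewrite mulr_ge0// sumr_ge0.
move=> y y1; have y0 : 0 < y by exact: lt_le_trans y1.
have py : `|p.[y]| <= (\sum_(i < size p) `|p`_i|) * y ^+ size p.
  rewrite horner_coef (le_trans (ler_norm_sum _ _ _))// mulr_suml.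
  apply: ler_sum => i _; rewrite normrM ler_wpM2l// normrX (ger0_norm (ltW y0)).
  by rewrite ler_weXn2l// ltnW.
(* One term of the exponential series is kept; its degree exceeds that of the bound on p by 2, which
   leaves the factor y^-2. *)
have ey : expR (- y) <= ((size p).+2)`!%:R * y ^- (size p).+2.
  rewrite expRN -[leRHS]invrK lef_pV2 ?posrE ?expR_gt0//; last first.
    by rewrite invr_gt0 mulr_gt0 ?invr_gt0 ?exprn_gt0// ltr0n fact_gt0.
  rewrite invfM invrK mulrC.
  by have := expR_ge1Dxn (size p).+1 (ltW y0); lra.
have e0 := expR_ge0 (- y).
apply: (le_trans (ler_wpM2r e0 py)).
apply: (le_trans (ler_wpM2l _ ey)).
  by rewrite mulr_ge0// ?sumr_ge0// exprn_ge0// ltW.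
rewrite le_eqVlt; apply/orP; left; apply/eqP.
rewrite -addn2 exprD; field.
by rewrite ?expf_neq0// gt_eqF.
Qed.

(** The difference quotient at 0 is at most C |h|. For [flat], the quadratic bound is
    [horner_le_expR] at y = 1/h. *)
Lemma is_derive_at0_sqr_bound f (C d : R) : 0 < d -> f 0 = 0 ->
  (forall h, `|h| <= d -> `|f h| <= C * h ^+ 2) -> is_derive (0 : R) 1 f 0.
Proof.
move=> d0 f0 H.
suff L : h^-1 *: (f (h *: 1 + 0) - f 0) @[h --> 0^'] --> (0 : R).
  split; first by apply/cvg_ex; exists 0; exact: L.
  exact/cvg_lim/L.
apply/cvgr0Pnorm_le => e e0.
near=> h.
have hn0 : h != 0 by near: h; exact: nbhs_dnbhs_neq.
have hd : `|h| <= d.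
  near: h; apply: nbhs_dnbhs; exists d => //= h /=; rewrite sub0r normrN; exact: ltW.
have hC : (`|C| + 1) * `|h| <= e.
  near: h; apply: nbhs_dnbhs; exists (e / (`|C| + 1)) => /=.
    by rewrite divr_gt0// ltr_wpDl.
  move=> h /=; rewrite sub0r normrN ltr_pdivlMr ?ltr_wpDl// mulrC; exact: ltW.
rewrite f0 subr0 addr0 /GRing.scale/= mulr1 normrM normfV.
rewrite ler_pdivrMl ?normr_gt0// (le_trans (H _ hd))//.
rewrite -(real_normK (num_real h)).
have := ler_norm C; have := normr_ge0 h; have := normr_ge0 C.
nra.
Unshelve. all: by end_near. Qed.

Lemma is_derive_flat p x :
  is_derive x 1 (flat p) (flat ('X^2 * (p - p^`())) x).
Proof.
have [x0|x0|->] := ltgtP x 0.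
- rewrite {2}/flat ltNge (ltW x0)/=.
  apply: (@near_eq_is_derive R R^o R^o (cst 0)).
  near=> y; rewrite /flat ltNge ltW//.
  by near: y; exact: lt_nbhsl.
- rewrite {2}/flat x0.
  apply: (@near_eq_is_derive R R^o R^o (fun y => p.[y^-1] * expR (- y^-1))).
    near=> y; rewrite /flat ifT//.
    by near: y; exact: lt_nbhsr.
  have xn0 : x != 0 by rewrite gt_eqF.
  have dV : is_derive x 1 (fun y : R => y^-1) (- x ^- 2).
    apply: DeriveDef; first exact: derivableV.
    by rewrite deriveV// derive_id scaler1.
  apply: is_derive_eq.
  rewrite /GRing.scale/= hornerM hornerXn hornerD hornerN -exprVn.
  set y := x^-1. set e := expR _. ring.
- rewrite {2}/flat ltxx.
  have [C C0 HC] := horner_le_expR p.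
  apply: (@is_derive_at0_sqr_bound _ C 1) => //; first by rewrite /flat ltxx.
  move=> h h1; rewrite /flat; case: ifPn => [h0|_]; last first.
    by rewrite normr0 mulr_ge0// sqr_ge0.
  rewrite normrM (ger0_norm (expR_ge0 _)).
  have := HC h^-1; rewrite invf_ge1// exprVn invrK; apply.
  by rewrite -(gtr0_norm h0).
Unshelve. all: by end_near. Qed.

End smooth_functions.

Section test_functions.
Context (R : realType).
Notation mu := (@lebesgue_measure R).
Implicit Types (f g phi psi : R -> R) (p : {poly R}) (x : R).

(** The smallest class containing the rescaled [flat p] that is visibly stable under derivation, so
    that [smooth_coind] applies to bumps built as products. *)
Inductive flat_alg : (R -> R) -> Prop :=
| flat_alg_aff p k c : flat_alg (fun x => flat p (k * x + c))
| flat_alg_cst c : flat_alg (fun=> c)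
| flat_alg_add f g : flat_alg f -> flat_alg g -> flat_alg (fun x => f x + g x)
| flat_alg_mul f g : flat_alg f -> flat_alg g -> flat_alg (fun x => f x * g x).

Lemma flat_alg_derive f : flat_alg f ->
  exists2 g, flat_alg g & forall x, is_derive x 1 f (g x).
Proof.
elim=> [p k c|c|f1 f2 F1 [g1 G1 D1] F2 [g2 G2 D2]
  |f1 f2 F1 [g1 G1 D1] F2 [g2 G2 D2]].
- exists (fun x => flat ('X^2 * (p - p^`())) (k * x + c) * k).
    by apply: flat_alg_mul; [exact: flat_alg_aff|exact: flat_alg_cst].
  move=> x.
  have D1 : is_derive x 1 (fun x : R => k * x + c) k.
    by apply: is_derive_eq; rewrite addr0 /GRing.scale/=; ring.
  have D2 := is_derive_flat p (k * x + c).
  exact: (@is_derive1_comp _ (flat p) (fun x => k * x + c) x _ _ D2 D1).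
- by exists (fun=> 0); [exact: flat_alg_cst|move=> x; exact: is_derive_cst].
- exists (fun x => g1 x + g2 x); first exact: flat_alg_add.
  by move=> x; have := D1 x; have := D2 x => d1 d2; exact: is_deriveD.
- exists (fun x => f1 x * g2 x + f2 x * g1 x).
    by apply: flat_alg_add; exact: flat_alg_mul.
  by move=> x; have := D1 x; have := D2 x => d1 d2; exact: is_deriveM.
Qed.

Lemma flat_alg_smooth f : flat_alg f -> smooth f.
Proof.
apply: smooth_coind => {}f /flat_alg_derive[g Gg fg]; split.
  by move=> x; case: (fg x).
by rewrite (is_derive1_funext fg).
Qed.

Lemma is_derive_linear f g (k x : R) : smooth f -> smooth g ->
  is_derive x 1 (fun x => f x + k * g x) (derive1 f x + k * derive1 g x).
Proof.
move=> sf sg; have df := smooth_is_derive x sf; have dg := smooth_is_derive x sg.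
exact: (is_deriveD df (is_deriveZ k dg)).
Qed.

Lemma derive1_linear f g (k : R) : smooth f -> smooth g ->
  derive1 (fun x => f x + k * g x) = (fun x => derive1 f x + k * derive1 g x).
Proof.
by move=> sf sg; apply: is_derive1_funext => x; exact: is_derive_linear.
Qed.

Lemma smooth_linear f g (k : R) : smooth f -> smooth g ->
  smooth (fun x => f x + k * g x).
Proof.
move=> sf sg.
pose S h := exists f g : R -> R,
  [/\ smooth f, smooth g & h = (fun x => f x + k * g x)].
apply: (@smooth_coind _ S); last by exists f, g.
move=> _ [{sf sg}f [{}g [sf sg ->]]]; split.
  by move=> x; case: (is_derive_linear k x sf sg).
exists (derive1 f), (derive1 g).
by split; [exact: smooth_derive1|exact: smooth_derive1|exact: derive1_linear].
Qed.

(* For x < c the interval is empty and the value is 0. *)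
Definition prim (c : R) f x : R := \int[mu]_(t in `[c, x]) f t.

Lemma continuous_integrable f (c d : R) : continuous f ->
  mu.-integrable `[c, d] (EFin \o f).
Proof.
move=> cf; apply: continuous_compact_integrable; first exact: segment_compact.
exact: continuous_subspaceT.
Qed.

(** The fundamental theorem of calculus covers x > c only. At x <= c, the vanishing of [f] up to al
    > c makes the primitive zero near x. *)
Lemma prim_is_derive (c al : R) f : continuous f -> c < al ->
  (forall x, x <= al -> f x = 0) -> forall x, is_derive x 1 (prim c f) (f x).
Proof.
move=> cf cal f0 x; have [cx|xc] := ltP c x.
  have xx1 : x < x + 1 by rewrite ltrDl.
  have [] := continuous_FTC1_closed xx1 (continuous_integrable c (x + 1) cf) cx
    (cf x).
  by move=> dF fE; apply: (DeriveDef dF); rewrite -derive1E; exact: fE.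
rewrite f0 ?(le_trans xc (ltW cal))//.
apply: (@near_eq_is_derive R R^o R^o (cst 0)).
near=> y; rewrite /prim /=.
rewrite (@eq_Rintegral _ _ _ mu _ (cst 0)) ?Rintegral_cst ?mul0r//.
move=> t; rewrite inE/= in_itv/= => /andP[_ ty]; apply: f0.
rewrite (le_trans ty)// ltW//; near: y; apply: lt_nbhsl.
exact: le_lt_trans cal.
Unshelve. all: by end_near. Qed.

Lemma test_functionI (a b al be : R) phi : a < al -> be < b -> smooth phi ->
  (forall x, phi x != 0 -> al <= x <= be) -> test_function a b phi.
Proof.
move=> aal beb sphi H.
have cl : closure [set x | phi x != 0] `<=` `[al, be].
  rewrite [X in _ `<=` X](_ : _ = closure `[al, be]); last first.
    by apply/closure_id; exact: interval_closed.
  by apply: closure_subset => x /= /H; rewrite in_itv.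
split => //.
- apply: subclosed_compact (@segment_compact _ al be) cl.
  exact: closed_closure.
- by apply: (subset_trans cl); apply: subset_itv; rewrite bnd_simp.
Qed.

Lemma test_function_smooth (a b : R) phi : test_function a b phi -> smooth phi.
Proof. by case. Qed.

Lemma test_function_out (a b x : R) phi : test_function a b phi ->
  x \notin `]a, b[ -> phi x = 0.
Proof.
move=> [_ _ H] xab; apply: contraNeq xab => phix.
by have := H x; apply; exact: subset_closure.
Qed.

Lemma test_function_linear (a b k : R) phi psi :
  test_function a b phi -> test_function a b psi ->
  test_function a b (fun x => phi x + k * psi x).
Proof.
move=> tphi tpsi; have sl := @smooth_linear _ _ k (test_function_smooth tphi)
  (test_function_smooth tpsi).
move: tphi tpsi => [_ c1 i1] [_ c2 i2].
have cl : closure [set x | phi x + k * psi x != 0] `<=`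
    closure [set x | phi x != 0] `|` closure [set x | psi x != 0].
  rewrite -closureU; apply: closure_subset => x /=.
  have [->|] := eqVneq (phi x) 0; last by left.
  have [->|] := eqVneq (psi x) 0; last by right.
  by rewrite mulr0 addr0 eqxx.
split; first exact: sl.
- apply: subclosed_compact (compactU c1 c2) cl.
  exact: closed_closure.
- by apply: (subset_trans cl); rewrite subUset.
Qed.

Lemma flat1_bounds x : 0 <= flat 1 x <= 1.
Proof.
rewrite /flat; case: ifPn => [x0|_]; last by rewrite lexx ler01.
by rewrite hornerC mul1r expR_ge0 expR_le1 oppr_le0 invr_ge0 ltW.
Qed.

Lemma flat1_gt0 x : flat 1 x != 0 -> 0 < x.
Proof. by rewrite /flat; case: ifPn => //; rewrite eqxx. Qed.

Lemma flat1_ge x : 0 < x -> 1 - x^-1 <= flat 1 x.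
Proof. by move=> x0; rewrite /flat x0 hornerC mul1r expR_ge1Dx. Qed.

(** With N = n + 1 the two arguments are N (x - al) - 1 and N (be - x) - 1. The bump is therefore
    supported in [al + 1/N, be - 1/N], at positive distance from al and be, and tends to the
    indicator of (al, be) as N grows. *)
Definition flat_bump (al be : R) (n : nat) x : R :=
  flat 1 (n.+1%:R * x + (- (n.+1%:R * al) - 1)) *
  flat 1 (- n.+1%:R * x + (n.+1%:R * be - 1)).

Lemma flat_bump_flat_alg al be n : flat_alg (flat_bump al be n).
Proof. by apply: flat_alg_mul; exact: flat_alg_aff. Qed.

Lemma flat_bump_bounds al be n x : 0 <= flat_bump al be n x <= 1.
Proof.
rewrite /flat_bump; have /andP[h1 h2] := flat1_bounds (n.+1%:R * x + (- (n.+1%:R * al) - 1)).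
have /andP[h3 h4] := flat1_bounds (- n.+1%:R * x + (n.+1%:R * be - 1)).
by rewrite mulr_ge0// mulr_ile1.
Qed.

Lemma flat_bump_support al be n x : flat_bump al be n x != 0 ->
  al + n.+1%:R^-1 <= x <= be - n.+1%:R^-1.
Proof.
rewrite /flat_bump mulf_eq0 negb_or => /andP[/flat1_gt0 h1 /flat1_gt0 h2].
have N0 : 0 < n.+1%:R :> R by rewrite ltr0n.
have e : n.+1%:R * n.+1%:R^-1 = 1 :> R by rewrite divff ?gt_eqF.
apply/andP; split; rewrite -(ler_pM2l N0) ?mulrDr ?mulrN e; lra.
Qed.

Lemma flat_bump_cvg al be x : al < x < be -> flat_bump al be n x @[n --> \oo] --> (1 : R).
Proof.
move=> /andP[alx xbe].
have H (d : R) : 0 < d -> flat 1 (n.+1%:R * d - 1) @[n --> \oo] --> (1 : R).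
  move=> d0; apply/cvgrPdist_le => e e0.
  near=> n.
  (* Makes (n + 1) d - 1 at least 1/e, so that [flat1_ge] gives a value at least 1 - e. *)
  have t0 : (1 + e^-1) / d <= n%:R by near: n; exact: nbhs_infty_ger.
  have t1 : e^-1 <= n.+1%:R * d - 1.
    rewrite -natr1 mulrDl mul1r; rewrite ler_pdivrMr// in t0; lra.
  have e0' : 0 < e^-1 by rewrite invr_gt0.
  have T0 : 0 < n.+1%:R * d - 1 by exact: lt_le_trans t1.
  have /andP[_ h1] := flat1_bounds (n.+1%:R * d - 1).
  rewrite ger0_norm ?subr_ge0// lerBlDr -lerBlDl.
  apply: le_trans (flat1_ge T0); rewrite lerB// -[leRHS]invrK.
  by rewrite lef_pV2 ?posrE.
rewrite /flat_bump -[X in _ --> X](mulr1 1); apply: cvgM.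
- under eq_fun do rewrite addrA -mulrBr.
  by apply: H; rewrite subr_gt0.
- under eq_fun do rewrite addrA mulNr [X in X - 1]addrC -mulrBr.
  by apply: H; rewrite subr_gt0.
Unshelve. all: by end_near. Qed.

End test_functions.

Section dominated.
Context d (T : measurableType d) (R : realType).
Context (mu : {measure set T -> \bar R}).

Lemma dominated_cvg_Rintegral (A : set T) (f_ : (T -> R)^nat) (f g : T -> R) :
  measurable A -> (forall n, measurable_fun A (f_ n)) -> measurable_fun A f ->
  (forall x, A x -> f_ n x @[n --> \oo] --> f x) ->
  mu.-integrable A (EFin \o g) ->
  (forall n x, A x -> `|f_ n x| <= g x) ->
  \int[mu]_(x in A) f_ n x @[n --> \oo] --> \int[mu]_(x in A) f x.
Proof.
move=> mA mf_ mf ff gi fg.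
have [] := @dominated_convergence _ _ _ mu A mA (fun n => EFin \o f_ n)
  (EFin \o f) (EFin \o g).
- by move=> n; exact/measurable_EFinP.
- exact/measurable_EFinP.
- by apply: aeW => x Ax; apply: cvg_EFin; [exact: nearW|exact: ff].
- exact: gi.
- by apply: aeW => x n Ax; rewrite lee_fin; exact: fg.
move=> fi _ cv; rewrite /Rintegral; apply: fine_cvg.
by rewrite fineK//; exact: integrable_fin_num.
Qed.

End dominated.

(** * The fundamental lemma of the calculus of variations *)

Section fundamental_lemma.
Context (R : realType).
Notation mu := (@lebesgue_measure R).
Implicit Types (f g phi psi : R -> R) (x al be a b : R).

Lemma continuous_measurable_on f (i : interval R) : continuous f ->
  measurable_fun ([set` i] : set (measurableTypeR R)) f.
Proof. by move=> cf; apply: measurable_funTS; exact: continuous_measurable_fun. Qed.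

Lemma flat_bump_continuous al be n : continuous (flat_bump al be n).
Proof. exact/smooth_continuous/flat_alg_smooth/flat_bump_flat_alg. Qed.

Lemma flat_bump_cvg_indic al be x :
  flat_bump al be n x @[n --> \oo] --> (\1_(`]al, be[%classic) x : R).
Proof.
rewrite indicE; case: (boolP (x \in `]al, be[%classic)) => [|xn].
  by rewrite inE/= in_itv/= => h; exact: flat_bump_cvg.
rewrite [X in X @ _ --> _](_ : _ = cst 0); first exact: cvg_cst.
apply/funext => n; apply/eqP; apply: contraNT xn => /flat_bump_support/andP[h1 h2].
have N0 : 0 < n.+1%:R^-1 :> R by rewrite invr_gt0 ltr0n.
rewrite inE/= in_itv/=; move: (n.+1%:R^-1) N0 h1 h2 => N N0 h1 h2; lra.
Qed.

Lemma flat_bump_test_function a b al be n : a <= al -> be <= b ->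
  test_function a b (flat_bump al be n).
Proof.
move=> aal beb; have N0 : 0 < n.+1%:R^-1 :> R by rewrite invr_gt0 ltr0n.
apply: (@test_functionI _ _ _ (al + n.+1%:R^-1) (be - n.+1%:R^-1)).
- by move: (n.+1%:R^-1) N0 => N N0; lra.
- by move: (n.+1%:R^-1) N0 => N N0; lra.
- exact/flat_alg_smooth/flat_bump_flat_alg.
- exact: flat_bump_support.
Qed.

Lemma Rintegral_mul_indic (A B : set R) f : measurable A -> measurable B ->
  B `<=` A ->
  \int[mu]_(x in A) (f x * \1_B x) = \int[mu]_(x in B) f x.
Proof.
move=> mA mB BA; rewrite -[in RHS](setIidr BA) Rintegral_mkcondr.
apply: eq_Rintegral => x _; rewrite patchE indicE.
by case: (x \in B); rewrite ?mulr1 ?mulr0.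
Qed.

(** Testing with bumps and dominated convergence give zero integrals over all subintervals. By
    Lebesgue differentiation, g is almost everywhere the derivative of its primitive, which is
    identically 0. *)
Lemma fundamental_lemma a b g : mu.-integrable `]a, b[ (EFin \o g) ->
  (forall phi, test_function a b phi -> \int[mu]_(x in `]a, b[) (g x * phi x) = 0) ->
  {ae mu, forall x, `]a, b[%classic x -> g x = 0}.
Proof.
move=> gi g0.
have mg : measurable_fun `]a, b[ g by apply/measurable_EFinP; exact: measurable_int gi.
have H al be : a <= al -> be <= b -> \int[mu]_(x in `]al, be[) g x = 0.
  move=> aal beb.
  have sub : `]al, be[ `<=` `]a, b[ by apply: subset_itv; rewrite bnd_simp.
  have : \int[mu]_(x in `]a, b[) (g x * flat_bump al be n x) @[n --> \oo] -->
     \int[mu]_(x in `]a, b[) (g x * \1_(`]al, be[%classic) x).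
    apply: (@dominated_cvg_Rintegral _ _ _ mu `]a, b[
      (fun n x => g x * flat_bump al be n x)
      (fun x => g x * \1_(`]al, be[%classic) x) (Num.norm \o g)) => //.
    - move=> n; apply: measurable_funM => //.
      by have := @continuous_measurable_on _ `]a, b[ (@flat_bump_continuous al be n).
    - apply: measurable_funM => //.
    - by move=> x _; apply: cvgM; [exact: cvg_cst|exact: flat_bump_cvg_indic].
    - exact: integrable_norm.
    - move=> n x _; rewrite normrM /= ler_piMr//.
      by have /andP[h1 h2] := flat_bump_bounds al be n x; rewrite ger0_norm.
  rewrite Rintegral_mul_indic// => cv.
  apply: (cvg_unique _ cv); first exact: Rhausdorff.
  rewrite /= (_ : (fun n => _) = cst 0); first exact: cvg_cst.
  by apply/funext => n; apply: g0; exact: flat_bump_test_function.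
(* Extension by zero, for differentiation of the primitive from minus infinity on the whole line. *)
pose h := g \_ `]a, b[.
have hi : mu.-integrable setT (EFin \o h).
  rewrite /h -restrict_EFin; apply/integrable_restrict => //=; rewrite setTI//.
have hl : locally_integrable setT h by exact: integrable_locally.
have hy y : mu.-integrable `]-oo, y] (EFin \o h) by exact: integrableS hi.
have := FTC1Ny hy hl; apply: filterS; first exact: (ae_filter_ringOfSetsType mu).
move=> x [_ dh] xab.
have -> : g x = h x by rewrite /h patchE mem_set.
rewrite -dh.
rewrite (_ : (fun x => _) = cst 0) ?derive1_cst//.
apply/funext => y; rewrite /h -Rintegral_mkcondr /=.
have [yb|by_] := ltP y b; last first.
  rewrite (_ : _ `&` _ = `]a, b[%classic) ?H//.
  apply/seteqP; split => z /=; rewrite !in_itv/=; first by case.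
  by move=> zab; split => //; case/andP: zab => _ /ltW/le_trans; apply.
rewrite (_ : _ `&` _ = `]a, y]%classic); last first.
  apply/seteqP; split => z /=; rewrite !in_itv/=.
    by move=> [-> /andP[->]].
  by move=> /andP[-> zy]; split => //=; exact: le_lt_trans yb.
rewrite -Rintegral_itv_bndo_bndc ?H ?(ltW yb)//.
by apply: integrableS gi => //; apply: subset_itvl; rewrite bnd_simp ltW.
Qed.

End fundamental_lemma.

(** * Integrals and primitives on an interval *)

Section interval_integrals.
Context (R : realType).
Notation mu := (@lebesgue_measure R).
Implicit Types (f g phi psi : R -> R) (x c d k : R).

Lemma measurable_itvR (i : interval R) :
  measurable ([set` i] : set (measurableTypeR R)).
Proof. exact: measurable_itv. Qed.

(** The form in which every passage to the limit along approximating test functions is carried out;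
    C must not depend on e. *)
Lemma le0_eps (x C : R) : (forall e, 0 < e -> x <= C * e) -> x <= 0.
Proof.
move=> H; rewrite leNgt; apply/negP => x0.
have C0 : 0 < `|C| + 1 by rewrite ltr_wpDl.
have := H (x / (`|C| + 1) / 2); rewrite !divr_gt0// => /(_ isT).
apply/negP; rewrite -ltNge.
apply: (@le_lt_trans _ _ (x / 2)); last by lra.
rewrite mulrA ler_pM2r ?invr_gt0// mulrCA ger_pMr//.
by rewrite ler_pdivrMr// mul1r; have := ler_norm C; lra.
Qed.

Lemma lebesgue_oo_fin c d : (mu `]c, d[ < +oo)%E.
Proof.
by rewrite lebesgue_measure_itv/=; case: ifP => _; rewrite ltry.
Qed.

Lemma integrable_oo_cc f c d : mu.-integrable `]c, d[ (EFin \o f) ->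
  mu.-integrable `[c, d] (EFin \o f).
Proof.
move=> fi; have mf : measurable_fun `]c, d[ f.
  by apply/measurable_EFinP; exact: measurable_int fi.
have mfcc : measurable_fun `[c, d] f by exact: measurable_fun_itv_cc mf.
apply/integrableP; split; first exact/measurable_EFinP.
move/integrableP: fi => [_]; apply: le_lt_trans.
rewrite le_eqVlt; apply/orP; left; apply/eqP.
rewrite [RHS]integral_itv_bndo_bndc; last first.
  by apply/measurable_EFinP; exact: measurableT_comp.
rewrite integral_itv_obnd_cbnd//.
apply/measurable_EFinP; apply: measurableT_comp => //.
exact: measurable_fun_itv_oc mf.
Qed.

Lemma Rintegral_oo_cc f c d : mu.-integrable `]c, d[ (EFin \o f) ->
  \int[mu]_(x in `]c, d[) f x = \int[mu]_(x in `[c, d]) f x.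
Proof.
move=> fi; rewrite Rintegral_itv_bndo_bndc// Rintegral_itv_obnd_cbnd//.
by apply: integrableS (integrable_oo_cc fi) => //; exact: subset_itv_oc_cc.
Qed.

Lemma L2on_oo_cc f c d : L2on mu `]c, d[ f -> L2on mu `[c, d] f.
Proof.
by move=> [mf fi]; split; [exact: measurable_fun_itv_cc mf|exact: integrable_oo_cc].
Qed.

Lemma L2on_cst c d k : L2on mu `]c, d[ (fun=> k).
Proof.
by apply: (@L2on_bounded _ _ _ _ _ `|k|) => //; [exact: lebesgue_oo_fin|exact: aeW].
Qed.

Lemma L2on_integrable_oo f c d : L2on mu `]c, d[ f ->
  mu.-integrable `]c, d[ (EFin \o f).
Proof.
move=> Lf; have := L2on_mul_integrable (measurable_itvR _) (L2on_cst c d 1) Lf.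
by apply: eq_integrable => // x _ /=; rewrite mul1r.
Qed.

Lemma Rintegral_subset (A B : set R) f : measurable A -> measurable B ->
  A `<=` B -> mu.-integrable B (EFin \o f) -> (forall x, 0 <= f x) ->
  \int[mu]_(x in A) f x <= \int[mu]_(x in B) f x.
Proof.
move=> mA mB AB fi f0; rewrite /Rintegral fine_le//.
- by apply: integrable_fin_num => //; exact: integrableS fi.
- exact: integrable_fin_num.
apply: ge0_subset_integral => //; first exact: measurable_int fi.
by move=> x _; rewrite lee_fin.
Qed.

Lemma Rintegral_cst_itv c d k : c <= d -> \int[mu]_(x in `[c, d]) k = k * (d - c).
Proof.
move=> cd; rewrite Rintegral_cst//= lebesgue_measure_itv/= lte_fin.
by move: cd; rewrite le_eqVlt => /predU1P[->|->]; rewrite ?ltxx ?subrr.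
Qed.

Lemma prim_linear c d f g k x : mu.-integrable `[c, d] (EFin \o f) ->
  mu.-integrable `[c, d] (EFin \o g) -> x <= d ->
  prim c (fun t => f t + k * g t) x = prim c f x + k * prim c g x.
Proof.
move=> fi gi xd; have sub : `[c, x] `<=` `[c, d].
  by apply: subset_itvl; rewrite bnd_simp.
have fi' : mu.-integrable `[c, x] (EFin \o f) by exact: integrableS fi.
have gi' : mu.-integrable `[c, x] (EFin \o g) by exact: integrableS gi.
rewrite /prim RintegralD ?RintegralZl//.
by have := integrableZl (measurable_itvR _) k gi'.
Qed.

(** Cauchy-Schwarz against the constant 1. It turns mean-square closeness of derivatives into
    uniform closeness of primitives. *)
Lemma prim_sqr_le c d h x : L2on mu `]c, d[ h -> x <= d -> c <= d ->
  prim c h x ^+ 2 <= (d - c) * \int[mu]_(t in `]c, d[) (h t ^+ 2).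
Proof.
move=> Lh xd cd; have Lcc := L2on_oo_cc Lh.
have sub : `[c, x] `<=` `[c, d] by apply: subset_itvl; rewrite bnd_simp.
have Lx : L2on mu `[c, x] h by exact: L2on_sub Lcc.
have L1 : L2on mu `[c, x] (fun=> 1).
  by apply: L2on_sub (L2on_oo_cc (L2on_cst c d 1)).
have := cauchy_schwarz_sqr (measurable_itvR _) L1 Lx.
rewrite (@eq_Rintegral _ _ _ mu _ h); last by move=> t _; rewrite mul1r.
move/le_trans; apply.
have [cx|xc] := leP c x; last first.
  rewrite set_itv_ge ?bnd_simp -?ltNge// !Rintegral_set0 mul0r.
  by rewrite mulr_ge0 ?subr_ge0// Rintegral_sqr_ge0.
rewrite (@eq_Rintegral _ _ _ mu _ (fun=> 1) (fun=> 1 ^+ 2)); last first.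
  by move=> t _; rewrite expr1n.
rewrite Rintegral_cst_itv// mul1r ler_pM ?subr_ge0 ?Rintegral_sqr_ge0//.
  by rewrite lerB.
rewrite Rintegral_oo_cc; last by case: Lh.
apply: Rintegral_subset => //; first by case: Lcc.
by move=> t; exact: sqr_ge0.
Qed.

Lemma prim_continuous c d f : c <= d -> mu.-integrable `[c, d] (EFin \o f) ->
  {within `[c, d], continuous (prim c f)}.
Proof. by move=> cd fi; exact: parameterized_integral_continuous. Qed.

Lemma within_continuous_L2on c d f : {within `[c, d], continuous f} ->
  L2on mu `]c, d[ f.
Proof.
move=> cf.
have H : L2on mu `[c, d] f.
  split.
    by apply: subspace_continuous_measurable_fun => //; exact: measurable_itv.
  apply: continuous_compact_integrable; first exact: segment_compact.
  by move=> x; apply: cvgM; exact: cf.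
by apply: L2on_sub H => //; exact: subset_itv_oo_cc.
Qed.

End interval_integrals.

(** * Weak derivatives *)

Section weak_derivatives.
Context (R : realType) (a b : R) (hab : a < b).
Notation mu := (@lebesgue_measure R).
Notation E := (`]a, b[%classic : set (measurableTypeR R)).
Implicit Types (u v f g h phi psi : R -> R) (x k : R).

Let mE : measurable E := measurable_itvR _.

Lemma ae_imp (P Q : R -> Prop) : (forall x, P x -> Q x) ->
  {ae mu, forall x, P x} -> {ae mu, forall x, Q x}.
Proof. by move=> PQ; apply: filterS PQ; exact: (ae_filter_ringOfSetsType mu). Qed.

Lemma ae_imp2 (P Q S : R -> Prop) : (forall x, P x -> Q x -> S x) ->
  {ae mu, forall x, P x} -> {ae mu, forall x, Q x} -> {ae mu, forall x, S x}.
Proof. by move=> PQ; apply: filterS2 PQ; exact: (ae_filter_ringOfSetsType mu). Qed.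

Lemma L2norm_sqr A f : L2norm A f ^+ 2 = \int[mu]_(x in A) (f x ^+ 2).
Proof. exact: fine_Lnorm2_sqr. Qed.

Lemma Lp2P f : Lp `]a, b[ 2%:E f <-> L2on mu E f.
Proof. exact: Lfun2_restrictP. Qed.

Lemma continuous_L2on f : continuous f -> L2on mu E f.
Proof. by move=> cf; apply: within_continuous_L2on; exact: continuous_subspaceT. Qed.

Lemma smooth_L2on f : smooth f -> L2on mu E f.
Proof. by move=> sf; exact/continuous_L2on/smooth_continuous. Qed.

Lemma smooth_derive1_L2on f : smooth f -> L2on mu E (derive1 f).
Proof. by move=> sf; exact/smooth_L2on/smooth_derive1. Qed.

Lemma derivable_LRcontinuous f c d : (forall x, derivable f x 1) ->
  derivable_oo_LRcontinuous f c d.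
Proof.
move=> df; have cf := derivable1_continuous df; split => //.
- by apply: cvg_at_right_filter; exact: cf.
- by apply: cvg_at_left_filter; exact: cf.
Qed.

Lemma smooth_by_parts f phi : smooth f -> test_function a b phi ->
  \int[mu]_(x in `]a, b[) (f x * derive1 phi x) =
  - \int[mu]_(x in `]a, b[) (derive1 f x * phi x).
Proof.
move=> sf tphi; have sphi := test_function_smooth tphi.
have H (p q : R -> R) : smooth p -> smooth q ->
    mu.-integrable `]a, b[ (EFin \o (fun x => p x * q x)).
  by move=> sp sq; apply: (L2on_mul_integrable mE); exact: smooth_L2on.
have i1 := H _ _ sf (smooth_derive1 sphi).
have i2 := H _ _ (smooth_derive1 sf) sphi.
rewrite (Rintegral_oo_cc i1) (Rintegral_oo_cc i2).
rewrite (@Rintegration_by_parts _ f phi (derive1 f) (derive1 phi) a b)//.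
- rewrite !(test_function_out tphi) ?in_itv/= ?ltxx ?andbF//.
  by rewrite !mulr0 subrr sub0r.
- exact/continuous_subspaceT/smooth_continuous/smooth_derive1.
- by apply: derivable_LRcontinuous => x; exact: smooth_derivable.
- exact/continuous_subspaceT/smooth_continuous/smooth_derive1.
- by apply: derivable_LRcontinuous => x; exact: smooth_derivable.
Qed.

(** The parallelogram identity with the square of f - g dropped. *)
Lemma Rintegral_sqrD_le (A : set (measurableTypeR R)) f g : measurable A ->
  L2on mu A f -> L2on mu A g ->
  \int[mu]_(x in A) ((f x + g x) ^+ 2) <=
  2 * \int[mu]_(x in A) (f x ^+ 2) + 2 * \int[mu]_(x in A) (g x ^+ 2).
Proof.
move=> mA Lf Lg; have := Rintegral_sqr_ge0 mu A (fun x => f x + (-1) * g x).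
rewrite (Rintegral_sqrD (-1) mA Lf Lg).
have := Rintegral_sqrD 1 mA Lf Lg.
under eq_Rintegral do rewrite mul1r.
by move=> ->; lra.
Qed.

Lemma RintegralDZ (A : set (measurableTypeR R)) f g k : measurable A ->
  mu.-integrable A (EFin \o f) -> mu.-integrable A (EFin \o g) ->
  \int[mu]_(x in A) (f x + k * g x) =
  \int[mu]_(x in A) f x + k * \int[mu]_(x in A) g x.
Proof.
move=> mA fi gi; rewrite RintegralD//; last first.
  by have := integrableZl mA k gi.
by rewrite RintegralZl.
Qed.

Lemma is_weak_derivative_linear u v g h k :
  L2on mu E u -> L2on mu E v -> L2on mu E g -> L2on mu E h ->
  is_weak_derivative a b u g -> is_weak_derivative a b v h ->
  is_weak_derivative a b (fun x => u x + k * v x) (fun x => g x + k * h x).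
Proof.
move=> Lu Lv Lg Lh wu wv phi tphi.
have sphi := test_function_smooth tphi.
have L1 := smooth_L2on sphi; have L2 := smooth_derive1_L2on sphi.
have D (p q r : R -> R) : L2on mu E p -> L2on mu E q -> L2on mu E r ->
    \int[mu]_(x in `]a, b[) ((p x + k * q x) * r x) =
    \int[mu]_(x in `]a, b[) (p x * r x) + k * \int[mu]_(x in `]a, b[) (q x * r x).
  move=> Lp Lq Lr; rewrite -RintegralDZ//; try exact: L2on_mul_integrable.
  by apply: eq_Rintegral => x _; ring.
by rewrite !D// wu// wv//; ring.
Qed.

Lemma is_weak_derivative_unique u g h : L2on mu E g -> L2on mu E h ->
  is_weak_derivative a b u g -> is_weak_derivative a b u h ->
  {ae mu, forall x, E x -> g x = h x}.
Proof.
move=> Lg Lh wg wh.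
have Lgh := L2onB mE Lg Lh.
have := @fundamental_lemma _ a b _ (L2on_integrable_oo Lgh).
move=> /(_ _)/wrap[].
  move=> phi tphi; have L1 := smooth_L2on (test_function_smooth tphi).
  under eq_Rintegral do rewrite mulrBl.
  rewrite RintegralB//; try exact: L2on_mul_integrable.
  by apply/eqP; rewrite subr_eq0 -eqr_opp -wg// -wh.
by apply: ae_imp => x /= H Ex; apply/eqP; rewrite -subr_eq0 H.
Qed.

(** Exhibiting any square-integrable weak derivative rules out the default value of the choice, and
    uniqueness identifies the chosen one with it almost everywhere. *)
Lemma wderivP u g : L2on mu E g -> is_weak_derivative a b u g ->
  [/\ L2on mu E (wderiv a b u), is_weak_derivative a b u (wderiv a b u) &
      {ae mu, forall x, E x -> wderiv a b u x = g x}].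
Proof.
move=> Lg wg; have [] : Lp `]a, b[ 2%:E (wderiv a b u) /\
    is_weak_derivative a b u (wderiv a b u).
  by rewrite /wderiv; case: xgetP => [y _ //|/(_ g)[]]; split => //; exact/Lp2P.
by move=> /Lp2P Lw ww; split => //; exact: is_weak_derivative_unique ww wg.
Qed.

Lemma smooth_weak_derivative f : smooth f -> is_weak_derivative a b f (derive1 f).
Proof. by move=> sf phi tphi; exact: smooth_by_parts. Qed.

Definition test_approx u g := [/\ L2on mu E u, L2on mu E g &
  forall e, 0 < e -> exists phi, [/\ test_function a b phi,
    \int[mu]_(x in `]a, b[) ((u x - phi x) ^+ 2) <= e &
    \int[mu]_(x in `]a, b[) ((g x - derive1 phi x) ^+ 2) <= e]].

(** Integration by parts holds exactly for the approximating phi, and Cauchy-Schwarz controls the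
    two remainders. *)
Lemma test_approx_weak_derivative u g : test_approx u g ->
  is_weak_derivative a b u g.
Proof.
move=> [Lu Lg app] psi tpsi.
have spsi := test_function_smooth tpsi.
have L1 := smooth_L2on spsi; have L2 := smooth_derive1_L2on spsi.
set X := Rintegral _ _ _; set Y := Rintegral _ _ _.
pose p := \int[mu]_(x in `]a, b[) (derive1 psi x ^+ 2).
pose q := \int[mu]_(x in `]a, b[) (psi x ^+ 2).
suff : (X + Y) ^+ 2 <= 0.
  move=> h; have : X + Y == 0 by rewrite -sqrf_eq0 eq_le h sqr_ge0.
  by rewrite addr_eq0 => /eqP.
apply: (@le0_eps _ _ (2 * p + 2 * q)) => e e0.
have [phi [tphi h1 h2]] := app e e0.
have sphi := test_function_smooth tphi.
have L3 := smooth_L2on sphi; have L4 := smooth_derive1_L2on sphi.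
pose P := \int[mu]_(x in `]a, b[) ((u x - phi x) * derive1 psi x).
pose Q := \int[mu]_(x in `]a, b[) ((g x - derive1 phi x) * psi x).
(* The contributions of [phi] to P and Q cancel by parts. *)
have -> : X + Y = P + Q.
  rewrite /P /Q; under eq_Rintegral do rewrite mulrBl.
  rewrite RintegralB//; try exact: L2on_mul_integrable.
  under [X in _ = _ + X]eq_Rintegral do rewrite mulrBl.
  rewrite RintegralB//; try exact: L2on_mul_integrable.
  by rewrite (smooth_by_parts sphi tpsi) -/X -/Y; ring.
have hP : P ^+ 2 <= e * p.
  apply: (le_trans (cauchy_schwarz_sqr mE (L2onB mE Lu L3) L2)).
  by rewrite ler_wpM2r// Rintegral_sqr_ge0.
have hQ : Q ^+ 2 <= e * q.
  apply: (le_trans (cauchy_schwarz_sqr mE (L2onB mE Lg L4) L1)).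
  by rewrite ler_wpM2r// Rintegral_sqr_ge0.
have := sqr_ge0 (P - Q); nra.
Qed.

Lemma L2_dist_linear p q r t k : L2on mu E p -> L2on mu E q ->
  L2on mu E r -> L2on mu E t ->
  \int[mu]_(x in `]a, b[) ((p x + k * q x - (r x + k * t x)) ^+ 2) <=
  2 * \int[mu]_(x in `]a, b[) ((p x - r x) ^+ 2) +
  2 * k ^+ 2 * \int[mu]_(x in `]a, b[) ((q x - t x) ^+ 2).
Proof.
move=> Lp Lq Lr Lt; have L1 := L2onB mE Lp Lr; have L2 := L2onB mE Lq Lt.
have := Rintegral_sqrD_le mE L1 (L2onZ k mE L2).
rewrite -mulrA -(RintegralZl _ mE); last by case: L2.
rewrite (@eq_Rintegral _ _ _ mu `]a, b[ (fun x => (k * (q x - t x)) ^+ 2)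
  (fun x => k ^+ 2 * (q x - t x) ^+ 2)); last by move=> x _; rewrite exprMn.
move=> H; apply: le_trans H; rewrite le_eqVlt; apply/orP; left; apply/eqP.
by apply: eq_Rintegral => x _; ring.
Qed.

Lemma test_approx_linear u v g h k : test_approx u g -> test_approx v h ->
  test_approx (fun x => u x + k * v x) (fun x => g x + k * h x).
Proof.
move=> [Lu Lg app] [Lv Lh app']; split.
- exact/(L2onD mE)/(L2onZ k mE).
- exact/(L2onD mE)/(L2onZ k mE).
move=> e e0.
have k2 : 0 <= k ^+ 2 by exact: sqr_ge0.
have C0 : 0 < 2 + 2 * k ^+ 2 by lra.
have [phi [tphi h1 h2]] := app _ (divr_gt0 e0 C0).
have [psi [tpsi h3 h4]] := app' _ (divr_gt0 e0 C0).
have s1 := test_function_smooth tphi; have s2 := test_function_smooth tpsi.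
have ee : e = 2 * (e / (2 + 2 * k ^+ 2)) + 2 * k ^+ 2 * (e / (2 + 2 * k ^+ 2)).
  by field; rewrite gt_eqF.
have bnd (p q : R) : p <= e / (2 + 2 * k ^+ 2) -> q <= e / (2 + 2 * k ^+ 2) ->
    2 * p + 2 * k ^+ 2 * q <= e.
  move=> hp hq; rewrite [leRHS]ee; apply: lerD; first by rewrite ler_pM2l.
  by apply: ler_wpM2l => //; rewrite mulr_ge0.
exists (fun x => phi x + k * psi x); split.
- exact: test_function_linear.
- apply: le_trans (L2_dist_linear k Lu Lv (smooth_L2on s1) (smooth_L2on s2)) _.
  exact: (bnd _ _ h1 h3).
- rewrite derive1_linear//.
  apply: le_trans (L2_dist_linear k Lg Lh (smooth_derive1_L2on s1)
    (smooth_derive1_L2on s2)) _.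
  exact: (bnd _ _ h2 h4).
Qed.

Lemma test_approx_test phi : test_function a b phi ->
  test_approx phi (derive1 phi).
Proof.
move=> tphi; have sphi := test_function_smooth tphi; split.
- exact: smooth_L2on.
- exact: smooth_derive1_L2on.
move=> e e0; exists phi; split => //.
- rewrite (@eq_Rintegral _ _ _ mu `]a, b[ (fun=> 0)).
    by rewrite Rintegral_cst// mul0r ltW.
  by move=> x _; rewrite subrr expr0n.
- rewrite (@eq_Rintegral _ _ _ mu `]a, b[ (fun=> 0)).
    by rewrite Rintegral_cst// mul0r ltW.
  by move=> x _; rewrite subrr expr0n.
Qed.

Lemma test_approx_wderiv u g : test_approx u g ->
  L2on mu E (wderiv a b u) /\ {ae mu, forall x, E x -> wderiv a b u x = g x}.
Proof.
move=> ug; have wg := test_approx_weak_derivative ug.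
by case: ug => _ Lg _; have [] := wderivP Lg wg.
Qed.

Lemma ae_eq_Rintegral_sqr f g : L2on mu E f -> L2on mu E g ->
  {ae mu, forall x, E x -> f x = g x} ->
  \int[mu]_(x in `]a, b[) (f x ^+ 2) = \int[mu]_(x in `]a, b[) (g x ^+ 2).
Proof.
move=> [mf _] [mg _] fg; apply: ae_eq_Rintegral => //.
- exact: measurable_funX.
- exact: measurable_funX.
- by apply: ae_imp fg => x /= H Ex; rewrite H.
Qed.

Lemma H1norm_sub_sqr u g phi : L2on mu E u -> L2on mu E g ->
  is_weak_derivative a b u g -> smooth phi ->
  L2norm `]a, b[ (u \- phi) ^+ 2 + L2norm `]a, b[ (wderiv a b (u \- phi)) ^+ 2 =
  \int[mu]_(x in `]a, b[) ((u x - phi x) ^+ 2) +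
  \int[mu]_(x in `]a, b[) ((g x - derive1 phi x) ^+ 2).
Proof.
move=> Lu Lg wg sphi; rewrite !L2norm_sqr; congr (_ + _).
have L1 := smooth_L2on sphi; have L2 := smooth_derive1_L2on sphi.
have := is_weak_derivative_linear (-1) Lu L1 Lg L2 wg (smooth_weak_derivative sphi).
rewrite (_ : (fun x => u x + -1 * phi x) = u \- phi); last first.
  by apply/funext => x /=; rewrite mulN1r.
rewrite (_ : (fun x => g x + -1 * _) = (fun x => g x - derive1 phi x)); last first.
  by apply/funext => x /=; rewrite mulN1r.
have L3 := L2onB mE Lg L2.
move=> /(wderivP L3)[Lw _ we].
exact: ae_eq_Rintegral_sqr.
Qed.

Lemma test_approx_H10 u g : test_approx u g -> H10 a b u.
Proof.
move=> ug; have wg := test_approx_weak_derivative ug.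
have [Lu Lg app] := ug.
split.
  by split; [exact/Lp2P|exists g; split => //; exact/Lp2P].
(* Two integrals of at most e^2 / 4 each keep the final inequality strict. *)
move=> e e0; have e4 : 0 < e ^+ 2 / 4 by rewrite divr_gt0// exprn_gt0.
have [phi [tphi h1 h2]] := app _ e4; exists phi => //.
rewrite /H1norm (H1norm_sub_sqr Lu Lg wg (test_function_smooth tphi)) -[ltRHS](gtr0_norm e0) -sqrtr_sqr.
rewrite ltr_sqrt ?exprn_gt0//; lra.
Qed.

End weak_derivatives.

(** * Elements of H^1_0 as primitives of their weak derivatives *)

Section H10_functions.
Context (R : realType) (a b : R) (hab : a < b).
Notation mu := (@lebesgue_measure R).
Notation E := (`]a, b[%classic : set (measurableTypeR R)).
Implicit Types (u v w f g h phi psi : R -> R) (x k : R).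

Let mE : measurable E := measurable_itvR _.

(** With [test_approx_H10], this trades the H^1 norm, which involves a separate choice of [wderiv]
    for each difference u - phi, for two plain integrals. *)
Lemma H10_test_approx u : H10 a b u -> test_approx a b u (wderiv a b u).
Proof.
move=> [[/Lp2P Lu [g [/Lp2P Lg wg]]] app].
have [Lw ww _] := wderivP Lg wg.
split => // e e0.
have se0 : 0 < Num.sqrt e by rewrite sqrtr_gt0.
have [phi tphi] := app _ se0.
rewrite /H1norm (H1norm_sub_sqr hab Lu Lw ww (test_function_smooth tphi)).
rewrite ltr_sqrt// => h; exists phi; split => //; apply/ltW; apply: le_lt_trans h.
- by rewrite lerDl Rintegral_sqr_ge0.
- by rewrite lerDr Rintegral_sqr_ge0.
Qed.

Lemma L2on_sqr0_ae f : L2on mu E f -> \int[mu]_(x in `]a, b[) (f x ^+ 2) = 0 ->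
  {ae mu, forall x, E x -> f x = 0}.
Proof.
move=> [mf fi] f0.
have mf2 : measurable_fun E (EFin \o (fun x => f x ^+ 2)).
  by apply/measurable_EFinP; exact: measurable_funX.
have : (\int[mu]_(x in E) `|(EFin \o (fun x => f x ^+ 2)%R) x| = 0)%E.
  rewrite (@eq_integral _ _ _ mu E (EFin \o (fun x => f x ^+ 2))); last first.
    by move=> x _; rewrite gee0_abs// lee_fin sqr_ge0.
  rewrite -[LHS]fineK; first by congr (_%:E).
  exact: integrable_fin_num.
move/(ae_eq_integral_abs mu mE mf2).
apply: ae_imp => x /= H Ex; have := H Ex => -[] /eqP.
by rewrite sqrf_eq0 => /eqP.
Qed.

Lemma test_function_prim phi x : test_function a b phi -> a <= x ->
  phi x = prim a (derive1 phi) x.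
Proof.
move=> tphi; rewrite le_eqVlt => /predU1P[<-|ax].
  by rewrite /prim set_itv1 Rintegral_set1 (test_function_out tphi)// in_itv/= ltxx.
have sphi := test_function_smooth tphi.
rewrite /prim /Rintegral (@continuous_FTC2 _ _ phi)//=.
- by rewrite (test_function_out tphi (x := a)) ?subr0// in_itv/= ltxx.
- exact/continuous_subspaceT/smooth_continuous/smooth_derive1.
- by apply: derivable_LRcontinuous => y; exact: smooth_derivable.
Qed.

Lemma L2on_integrable_cc f : L2on mu E f -> mu.-integrable `[a, b] (EFin \o f).
Proof. by move=> Lf; exact/integrable_oo_cc/L2on_integrable_oo. Qed.

Lemma L2on_prim f : L2on mu E f -> L2on mu E (prim a f).
Proof.
move=> Lf; apply: within_continuous_L2on; apply: prim_continuous.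
  exact: ltW.
exact: L2on_integrable_cc.
Qed.

Lemma prim_dist_sqr_le g h x : L2on mu E g -> L2on mu E h -> x <= b ->
  (prim a g x - prim a h x) ^+ 2 <=
  (b - a) * \int[mu]_(t in `]a, b[) ((g t - h t) ^+ 2).
Proof.
move=> Lg Lh xb; have := prim_sqr_le (L2onB mE Lg Lh) xb (ltW hab).
apply: le_trans; rewrite le_eqVlt; apply/orP; left; apply/eqP; congr (_ ^+ 2).
have := prim_linear (-1) (L2on_integrable_cc Lg) (L2on_integrable_cc Lh) xb.
by under eq_fun do rewrite mulN1r; rewrite mulN1r.
Qed.

Lemma Rintegral_le_cst f k : mu.-integrable E (EFin \o f) ->
  (forall x, E x -> f x <= k) -> \int[mu]_(x in `]a, b[) f x <= k * (b - a).
Proof.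
move=> fi fk; rewrite -(Rintegral_cst_itv k (ltW hab)) -Rintegral_oo_cc; last first.
  exact/L2on_integrable_oo/L2on_cst.
by apply: le_Rintegral => //; exact/L2on_integrable_oo/L2on_cst.
Qed.

Lemma prim_L2_dist g h : L2on mu E g -> L2on mu E h ->
  \int[mu]_(x in `]a, b[) ((prim a g x - prim a h x) ^+ 2) <=
  (b - a) ^+ 2 * \int[mu]_(t in `]a, b[) ((g t - h t) ^+ 2).
Proof.
move=> Lg Lh; rewrite expr2 mulrAC; apply: Rintegral_le_cst.
  by case: (L2onB mE (L2on_prim Lg) (L2on_prim Lh)).
move=> x /=; rewrite in_itv/= => /andP[_ /ltW xb].
exact: prim_dist_sqr_le.
Qed.

(** A test function is the primitive of its derivative and vanishes at b. Both facts pass to the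
    limit, the first in mean square and the second by the uniform bound on primitives. *)
Lemma test_approx_prim u g : test_approx a b u g ->
  {ae mu, forall x, E x -> u x = prim a g x} /\ prim a g b = 0.
Proof.
move=> [Lu Lg app]; have Lp := L2on_prim Lg; split.
  have : {ae mu, forall x, E x -> u x - prim a g x = 0}.
    apply: L2on_sqr0_ae; first exact: L2onB.
    apply/eqP; rewrite eq_le Rintegral_sqr_ge0 andbT.
    apply: (@le0_eps _ _ (2 + 2 * (b - a) ^+ 2)) => e e0.
    have [phi [tphi h1 h2]] := app e e0.
    have sphi := test_function_smooth tphi.
    have L1 := smooth_L2on a b sphi; have L2 := smooth_derive1_L2on a b sphi.
    have pE : \int[mu]_(x in `]a, b[) ((phi x - prim a g x) ^+ 2) =
              \int[mu]_(x in `]a, b[) ((prim a g x - prim a (derive1 phi) x) ^+ 2).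
      apply: eq_Rintegral => x; rewrite inE/= in_itv/= => /andP[/ltW ax _].
      by rewrite -test_function_prim// -sqrrN opprB.
    have := Rintegral_sqrD_le mE (L2onB mE Lu L1) (L2onB mE L1 Lp).
    under eq_Rintegral do rewrite addrA subrK.
    rewrite pE => /le_trans; apply.
    rewrite [leRHS](_ : _ = 2 * e + 2 * ((b - a) ^+ 2 * e)); last by ring.
    apply: lerD; rewrite ler_pM2l//; apply: le_trans (prim_L2_dist Lg L2) _.
    by rewrite ler_wpM2l ?sqr_ge0.
  by apply: ae_imp => x /= H Ex; apply/eqP; rewrite -subr_eq0 H.
apply/eqP; rewrite -sqrf_eq0 eq_le sqr_ge0 andbT.
apply: (@le0_eps _ _ (b - a)) => e e0.
have [phi [tphi h1 h2]] := app e e0.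
have sphi := test_function_smooth tphi.
have L2 := smooth_derive1_L2on a b sphi.
have := prim_dist_sqr_le Lg L2 (lexx b).
rewrite -(test_function_prim tphi (ltW hab)) (test_function_out tphi); last first.
  by rewrite in_itv/= ltxx andbF.
rewrite subr0 => /le_trans; apply; rewrite ler_wpM2l// subr_ge0 ltW//.
Qed.

(** The primitive of w vanishes, hence so does its derivative w at interior points; one-sided limits
    reach the ends. This gives uniqueness of the continuous representative. *)
Lemma within_continuous_eq0 w : {within `[a, b], continuous w} ->
  {ae mu, forall x, E x -> w x = 0} -> forall x, x \in `[a, b] -> w x = 0.
Proof.
move=> cw w0; have Lw := within_continuous_L2on cw.
have prim0 x : x <= b -> prim a w x = 0.
  move=> xb; have := prim_sqr_le Lw xb (ltW hab).
  rewrite (@ae_eq_Rintegral_sqr _ _ _ w (fun=> 0))//; last exact: L2on_cst.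
  rewrite (@eq_Rintegral _ _ _ mu `]a, b[ (fun=> 0)); last first.
    by move=> t _; rewrite expr0n.
  rewrite Rintegral_cst// mul0r mulr0 => h.
  by apply/eqP; rewrite -sqrf_eq0 eq_le h sqr_ge0.
have /(continuous_within_itvP _ hab)[cin ca cb] := cw.
have win x : x \in `]a, b[ -> w x = 0.
  move=> xab; move: (xab); rewrite in_itv/= => /andP[ax xb].
  have [_] := continuous_FTC1_closed xb (L2on_integrable_cc Lw) ax (cin x xab).
  move=> <-; rewrite derive1E.
  rewrite (@near_eq_derive R R^o R^o _ (fun=> 0)) ?derive_cst//.
  near=> y; apply: prim0; apply/ltW; near: y; exact: lt_nbhsl.
move=> x; rewrite in_itv/= => /andP[]; rewrite le_eqVlt => /predU1P[<- _|ax].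
  apply: (cvg_unique _ ca); first exact: Rhausdorff.
  apply: (@cvg_trans _ ((fun=> 0 : R) @ a^'+)); last exact: cvg_cst.
  apply: near_eq_cvg; near=> y; apply/esym/win; rewrite in_itv/=.
  by apply/andP; split; near: y; [exact: nbhs_right_gt|exact: nbhs_right_lt].
rewrite le_eqVlt => /predU1P[->|xb]; last by apply: win; rewrite in_itv/= ax.
apply: (cvg_unique _ cb); first exact: Rhausdorff.
apply: (@cvg_trans _ ((fun=> 0 : R) @ b^'-)); last exact: cvg_cst.
apply: near_eq_cvg; near=> y; apply/esym/win; rewrite in_itv/=.
by apply/andP; split; near: y; [exact: nbhs_left_gt|exact: nbhs_left_lt].
Unshelve. all: by end_near. Qed.

Lemma within_continuous_ae_eq v w : {within `[a, b], continuous v} ->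
  {within `[a, b], continuous w} -> {ae mu, forall x, E x -> v x = w x} ->
  forall x, x \in `[a, b] -> v x = w x.
Proof.
move=> cv cw vw x xab; apply/eqP; rewrite -subr_eq0; apply/eqP.
apply: (@within_continuous_eq0 (fun x => v x - w x)) => //.
- by move=> y; apply: cvgB; [exact: cv|exact: cw].
- by apply: ae_imp vw => y /= H Ey; rewrite H// subrr.
Qed.

Lemma cont_rep_eq u w : {within `[a, b], continuous w} ->
  {ae mu, forall x, E x -> u x = w x} ->
  forall x, x \in `[a, b] -> cont_rep a b u x = w x.
Proof.
move=> cw uw; have H : {ae mu, forall x, x \in `]a, b[ -> w x = u x}.
  by apply: ae_imp uw => x /= H xab; rewrite H.
rewrite /cont_rep; case: xgetP => [v _ /= [cv vu]|/(_ w)[]//].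
apply: within_continuous_ae_eq => //.
by apply: ae_imp2 vu H => x h1 h2 Ex; rewrite h1// h2.
Qed.

Lemma cont_rep_prim u g x : test_approx a b u g -> x \in `[a, b] ->
  cont_rep a b u x = prim a g x.
Proof.
move=> ug; have [_ Lg _] := ug; have [uE _] := test_approx_prim ug.
apply: cont_rep_eq => //; apply: prim_continuous; first exact: ltW.
exact: L2on_integrable_cc.
Qed.

End H10_functions.

(** * Density of test functions *)

Section density.
Context (R : realType) (a b : R) (hab : a < b).
Notation mu := (@lebesgue_measure R).
Notation E := (`]a, b[%classic : set (measurableTypeR R)).
Implicit Types (u v w f g h phi psi : R -> R) (x k : R).

Let mE : measurable E := measurable_itvR _.

(** The enclosing interval is kept explicit because [smooth_supported_prim] uses al and be to bound
    the support of the primitive. *)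
Definition smooth_supported psi := smooth psi /\
  exists al be, [/\ a < al, be < b & forall x, psi x != 0 -> al <= x <= be].

Lemma smooth_supported_linear phi psi k : smooth_supported phi ->
  smooth_supported psi -> smooth_supported (fun x => phi x + k * psi x).
Proof.
move=> [s1 [al1 [be1 [a1 b1 h1]]]] [s2 [al2 [be2 [a2 b2 h2]]]].
split; first exact: smooth_linear.
exists (Num.min al1 al2), (Num.max be1 be2); split.
- by rewrite lt_min a1.
- by rewrite gt_max b1.
move=> x; have [p0|/h1/andP[xl xu] _] := eqVneq (phi x) 0; last first.
  by rewrite ge_min xl le_max xu.
have [q0|/h2/andP[xl xu] _] := eqVneq (psi x) 0; last first.
  by rewrite ge_min xl le_max xu !orbT.
by rewrite p0 q0 mulr0 addr0 eqxx.
Qed.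

Definition test_dense g := L2on mu E g /\
  forall e, 0 < e -> exists2 psi, smooth_supported psi &
    \int[mu]_(x in `]a, b[) ((g x - psi x) ^+ 2) <= e.

Lemma test_dense_linear g h k : test_dense g -> test_dense h ->
  test_dense (fun x => g x + k * h x).
Proof.
move=> [Lg app] [Lh app']; split; first exact/(L2onD mE)/(L2onZ k mE).
move=> e e0.
have k2 : 0 <= k ^+ 2 by exact: sqr_ge0.
have C0 : 0 < 2 + 2 * k ^+ 2 by lra.
have [phi sphi h1] := app _ (divr_gt0 e0 C0).
have [psi spsi h2] := app' _ (divr_gt0 e0 C0).
exists (fun x => phi x + k * psi x); first exact: smooth_supported_linear.
have L1 := smooth_L2on a b sphi.1; have L2 := smooth_L2on a b spsi.1.
apply: le_trans (L2_dist_linear k Lg Lh L1 L2) _.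
rewrite [leRHS](_ : _ = 2 * (e / (2 + 2 * k ^+ 2)) +
    2 * k ^+ 2 * (e / (2 + 2 * k ^+ 2))); last by field; rewrite gt_eqF.
apply: lerD; first by rewrite ler_pM2l.
by apply: ler_wpM2l => //; rewrite mulr_ge0.
Qed.

Lemma test_dense_cst0 : test_dense (fun=> 0).
Proof.
split; first exact: L2on_cst.
move=> e e0; exists (fun=> 0).
  split; first exact/flat_alg_smooth/flat_alg_cst.
  exists ((a + b) / 2), ((a + b) / 2); split => //; rewrite ?midf_lt//.
  by move=> x; rewrite eqxx.
rewrite (@eq_Rintegral _ _ _ mu `]a, b[ (fun=> 0)); last first.
  by move=> x _; rewrite subr0 expr0n.
by rewrite Rintegral_cst// mul0r ltW.
Qed.

Lemma test_dense_sum (I : Type) (r : seq I) (m : I -> R) (F : I -> R -> R) :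
  (forall i, test_dense (F i)) ->
  test_dense (fun x => \sum_(i <- r) m i * F i x).
Proof.
move=> H; elim: r => [|i r ih].
  by under eq_fun do rewrite big_nil; exact: test_dense_cst0.
under eq_fun do rewrite big_cons addrC.
exact: test_dense_linear.
Qed.

Lemma flat_bump_smooth_supported al be n : a <= al -> be <= b ->
  smooth_supported (flat_bump al be n).
Proof.
move=> aal beb; have N0 : 0 < n.+1%:R^-1 :> R by rewrite invr_gt0 ltr0n.
split; first exact/flat_alg_smooth/flat_bump_flat_alg.
exists (al + n.+1%:R^-1), (be - n.+1%:R^-1); split.
- by move: (n.+1%:R^-1) N0 => N N0; lra.
- by move: (n.+1%:R^-1) N0 => N N0; lra.
- exact: flat_bump_support.
Qed.

Lemma test_dense_indic al be : a <= al -> be <= b ->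
  test_dense (\1_(`]al, be[%classic)).
Proof.
move=> aal beb; pose I : R -> R := \1_(`]al, be[%classic).
have mI : measurable_fun E I by exact: measurable_indic.
have LI : L2on mu E I.
  apply: (@L2on_bounded _ _ _ _ _ 1) => //; first exact: lebesgue_oo_fin.
  by apply: aeW => x _; rewrite /I indicE; case: (_ \in _); rewrite ?normr1 ?normr0.
split => // e e0.
have : \int[mu]_(x in `]a, b[) ((I x - flat_bump al be n x) ^+ 2) @[n --> \oo] -->
    \int[mu]_(x in `]a, b[) ((I x - I x) ^+ 2).
  apply: (@dominated_cvg_Rintegral _ _ _ mu E
    (fun n x => (I x - flat_bump al be n x) ^+ 2) (fun x => (I x - I x) ^+ 2)
    (fun=> 1)) => //.
  - move=> n; apply: measurable_funX; apply: measurable_funB => //.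
    by have := @continuous_measurable_on _ _ `]a, b[ (@flat_bump_continuous _ al be n).
  - by apply: measurable_funX; exact: measurable_funB.
  - move=> x _; apply: cvgM; apply: cvgB; (try exact: cvg_cst);
      exact: flat_bump_cvg_indic.
  - exact/L2on_integrable_oo/L2on_cst.
  move=> n x _; have /andP[h1 h2] := flat_bump_bounds al be n x.
  have /andP[h3 h4] : 0 <= I x <= 1.
    by rewrite /I indicE; case: (_ \in _); rewrite ?lexx ?ler01.
  by rewrite ger0_norm ?sqr_ge0//; nra.
rewrite (@eq_Rintegral _ _ _ mu `]a, b[ (fun=> 0)); last first.
  by move=> x _; rewrite subrr expr0n.
rewrite Rintegral_cst// mul0r => /cvgr0Pnorm_le/(_ e e0)[n _ /(_ n (leqnn _)) h].
exists (flat_bump al be n); first exact: flat_bump_smooth_supported.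
exact: le_trans (ler_norm _) h.
Qed.

(** Left of al the primitive is 0; right of be it is constant, with the value 0 taken at b. *)
Lemma smooth_supported_prim psi : smooth_supported psi -> prim a psi b = 0 ->
  test_function a b (prim a psi) /\ derive1 (prim a psi) = psi.
Proof.
move=> [spsi [al [be [aal beb H]]]] p0.
have cpsi := smooth_continuous spsi.
have D x : is_derive x 1 (prim a psi) (psi x).
  (* The midpoint, since the support hypothesis does not by itself give [psi al = 0]. *)
  apply: (@prim_is_derive _ a ((a + al) / 2)) => //.
    by rewrite midf_lt.
  move=> y yal; apply/eqP; apply: contraTT isT => /H/andP[aly _].
  exfalso; lra.
split; last exact: is_derive1_funext.
apply: (@test_functionI _ _ _ al be) => //; first exact: smooth_primitive D spsi.
move=> x; apply: contraR; rewrite negb_and -!ltNge => /orP[xal|bex].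
  apply/eqP; rewrite /prim (@eq_Rintegral _ _ _ mu _ (fun=> 0)).
    by rewrite Rintegral_cst// mul0r.
  move=> t; rewrite inE/= in_itv/= => /andP[_ tx].
  apply/eqP; apply: contraTT isT => /H/andP[alt _]; exfalso; lra.
have zero t : be < t -> psi t = 0.
  move=> bet; apply/eqP; apply: contraTT isT => /H/andP[_ tbe]; exfalso; lra.
have piece y z : be < y -> a <= y -> y <= z -> prim a psi z = prim a psi y.
  move=> bey ay yz; apply/eqP; rewrite -subr_eq0 /prim.
  rewrite Rintegral_itvB ?bnd_simp//; last exact: continuous_integrable.
  rewrite (@eq_Rintegral _ _ _ mu _ (fun=> 0)).
    by rewrite Rintegral_cst// mul0r.
  by move=> t; rewrite inE/= in_itv/= => /andP[yt _]; apply: zero; lra.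
have [ax|xa] := leP a x; last first.
  by apply/eqP; rewrite /prim set_itv_ge ?bnd_simp -?ltNge// Rintegral_set0.
have [xb|bx] := leP x b.
  by rewrite -(piece x b)// p0.
by rewrite (piece b x)// ?p0// ltW.
Qed.

(** An approximant psi of g need not have integral 0, so its primitive need not vanish at b. A
    multiple t of a fixed psi0 with positive integral repairs this, and t is small because g itself
    has integral 0. *)
Lemma test_dense_prim g : test_dense g -> prim a g b = 0 ->
  test_approx a b (prim a g) g.
Proof.
move=> dg p0; have [Lg app] := dg; split => //; first exact: L2on_prim.
have ba : 0 < b - a by rewrite subr_gt0.
(* An approximation of the indicator of (a, b) with squared error at most (b - a) / 4 has an
   integral within (b - a) / 2 of b - a. *)
have [psi0 s0 h0] : exists2 psi0, smooth_supported psi0 & 0 < prim a psi0 b.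
  have [L1 app1] := test_dense_indic (lexx a) (lexx b).
  have e0 : 0 < (b - a) / 4 by rewrite divr_gt0.
  have [psi0 s0 h0] := app1 _ e0; exists psi0 => //.
  have L0 := smooth_L2on a b s0.1.
  have := prim_dist_sqr_le hab L1 L0 (lexx b).
  have -> : prim a \1_`]a, b[ b = b - a.
    rewrite /prim -Rintegral_oo_cc; last exact: L2on_integrable_oo.
    rewrite (@eq_Rintegral _ _ _ mu _ (fun=> 1)).
      rewrite Rintegral_oo_cc; last exact/L2on_integrable_oo/L2on_cst.
      by rewrite Rintegral_cst_itv ?ltW// mul1r.
    by move=> x xE; rewrite indicE xE.
  move: h0; set X := Rintegral _ _ _ => hX h.
  rewrite ltNge; apply/negP => q0.
  have : (b - a) * X <= (b - a) * ((b - a) / 4) by rewrite ler_wpM2l// ltW.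
  by move: h q0 ba; set q := prim _ _ _; set c := b - a; nra.
set q := prim a psi0 b in h0.
have L0 := smooth_L2on a b s0.1.
pose S := \int[mu]_(x in `]a, b[) (psi0 x ^+ 2).
have S0 : 0 <= S by exact: Rintegral_sqr_ge0.
(* The cost of the repair: 2 for g - psi, and the rest for 2 t^2 S with t^2 bounded as in [ht]. *)
pose C := 2 + 2 * (b - a) * S / q ^+ 2.
have C0 : 0 < C.
  rewrite /C ltr_pwDl// divr_ge0 ?sqr_ge0// mulr_ge0// mulr_ge0// ltW//.
(* The added (b - a)^2 pays for the distance of the primitives, by [prim_L2_dist]. *)
move=> e e0; pose D := C * (1 + (b - a) ^+ 2).
have D0 : 0 < D by rewrite mulr_gt0// ltr_pwDl// sqr_ge0.
have [psi spsi h1] := app _ (divr_gt0 e0 D0).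
pose t := prim a psi b / q.
have L1 := smooth_L2on a b spsi.1.
have sd := smooth_supported_linear (- t) spsi s0.
have Ld := smooth_L2on a b sd.1.
have pd : prim a (fun x => psi x + - t * psi0 x) b = 0.
  rewrite (@prim_linear _ a b)//; try exact: L2on_integrable_cc.
  by rewrite -/q /t mulNr divfK ?gt_eqF// subrr.
have [tf dE] := smooth_supported_prim sd pd.
have ht : t ^+ 2 <= (b - a) * (e / D) / q ^+ 2.
  rewrite /t expr_div_n ler_pM2r ?invr_gt0 ?exprn_gt0//.
  have := prim_dist_sqr_le hab Lg L1 (lexx b).
  rewrite p0 sub0r sqrrN => /le_trans; apply.
  by rewrite ler_pM2l.
have key : \int[mu]_(x in `]a, b[) ((g x - (psi x + - t * psi0 x)) ^+ 2) <= C * (e / D).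
  have := Rintegral_sqrD_le mE (L2onB mE Lg L1) (L2onZ t mE L0).
  rewrite (@eq_Rintegral _ _ _ mu _ (fun x => (g x - (psi x + - t * psi0 x)) ^+ 2));
    last by move=> x _; congr (_ ^+ 2); ring.
  rewrite [X in _ + 2 * X](_ : _ = t ^+ 2 * S); last first.
    rewrite -RintegralZl//; last by case: L0.
    by apply: eq_Rintegral => x _; rewrite exprMn.
  move/le_trans; apply.
  rewrite [leRHS](_ : _ = 2 * (e / D) + 2 * ((b - a) * (e / D) / q ^+ 2 * S)); last first.
    by rewrite /C; ring.
  by apply: lerD; rewrite ler_pM2l// ler_wpM2r.
exists (prim a (fun x => psi x + - t * psi0 x)); split => //.
- apply: le_trans (prim_L2_dist hab Lg Ld) _.
  apply: (@le_trans _ _ ((b - a) ^+ 2 * (C * (e / D)))).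
    by rewrite ler_wpM2l ?sqr_ge0.
  rewrite mulrA mulrCA -[leRHS](mulr1 e) ler_pM2l// ler_pdivrMr// mul1r.
  rewrite mulrC ler_pM2l// lerDr//.
- rewrite dE; apply: le_trans key _.
  rewrite mulrCA -[leRHS](mulr1 e) ler_pM2l// ler_pdivrMr// mul1r.
  by rewrite -[leLHS]mulr1 ler_pM2l// lerDl sqr_ge0.
Qed.

End density.

(** * Piecewise affine functions on the mesh *)

Section mesh.
Context (R : realType) (a b : R) (s : seq R) (hs : itv_partition a b s).
Context (hab : a < b).
Notation mu := (@lebesgue_measure R).
Notation E := (`]a, b[%classic : set (measurableTypeR R)).
Notation node := (node a b s).
Notation element := (element a b s).
Implicit Types (u v w f g h phi psi : R -> R) (x : R) (j k : nat).

Let mE : measurable E := measurable_itvR _.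

Lemma node0 : node 0 = a. Proof. by []. Qed.

Lemma node_size : node (size s) = b.
Proof.
case: hs => _ /eqP <-; rewrite /Defs.node (last_nth b).
by rewrite (set_nth_default b).
Qed.

Lemma node_ltS k : (k < size s)%N -> node k < node k.+1.
Proof. by case: hs => /(pathP b) H _ /H. Qed.

Lemma node_le j k : (j <= k <= size s)%N -> node j <= node k.
Proof.
move=> /andP[]; elim: k => [|k ih]; first by rewrite leqn0 => /eqP->.
rewrite leq_eqVlt => /predU1P[->//|jk ks].
by rewrite (le_trans (ih jk (ltnW ks)))// ltW// node_ltS.
Qed.

Lemma node_ge k : (k <= size s)%N -> a <= node k.
Proof. by move=> ks; rewrite -[leLHS]node0 node_le. Qed.

Lemma node_leb k : (k <= size s)%N -> node k <= b.
Proof. by move=> ks; rewrite -[leRHS]node_size node_le// ks leqnn. Qed.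

Lemma element_sub k : (k < size s)%N -> element k `<=` `[a, b].
Proof.
move=> ks x; rewrite /Defs.element/= !in_itv/= => /andP[h1 h2].
rewrite (le_trans (node_ge (ltnW ks)) h1).
exact: le_trans h2 (node_leb ks).
Qed.

Lemma element_sub_oo k : (k < size s)%N ->
  `]node k, node k.+1[ `<=` (`]a, b[ : set R).
Proof.
move=> ks; apply: subset_itv; rewrite bnd_simp.
  exact: node_ge (ltnW ks).
exact: node_leb.
Qed.

Lemma mem_element x : x \in `[a, b] -> exists2 k, (k < size s)%N & element k x.
Proof.
rewrite in_itv/= => /andP[ax xb].
suff H n : (n <= size s)%N -> x <= node n ->
    x = a \/ exists2 k, (k < size s)%N & element k x.
  have [] := H (size s) (leqnn _); rewrite ?node_size//.
  move=> ->; have s0 : (0 < size s)%N.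
    rewrite lt0n; apply/eqP => s0; have := node_size; rewrite s0 node0 => ab.
    by move: hab; rewrite ab ltxx.
  by exists 0%N => //; rewrite /Defs.element/= in_itv/= lexx; exact/ltW/(node_ltS s0).
elim: n => [|n ih] ns xn.
  by left; apply/eqP; rewrite eq_le ax andbT; exact: xn.
have [/(ih (ltnW ns))//|nx] := leP x (node n).
by right; exists n => //; rewrite /Defs.element/= in_itv/= (ltW nx).
Qed.

Lemma Rintegral_element f k : mu.-integrable `]a, b[ (EFin \o f) ->
  (k < size s)%N ->
  \int[mu]_(x in element k) f x = prim a f (node k.+1) - prim a f (node k).
Proof.
move=> fi ks; have fcc := integrable_oo_cc fi.
have fk : mu.-integrable `[a, node k.+1] (EFin \o f).
  apply: integrableS fcc => //; apply: subset_itvl; rewrite bnd_simp.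
  exact: node_leb.
rewrite /prim Rintegral_itvB ?bnd_simp//; last 2 first.
- exact: node_ge (ltnW ks).
- by rewrite ltW// node_ltS.
rewrite Rintegral_itv_obnd_cbnd//.
apply: integrableS fk => //; apply: subset_itvr; rewrite bnd_simp.
exact: node_ge (ltnW ks).
Qed.

(** A telescoping sum of nodal values of the primitive, so that the nodes shared by closed elements
    need no separate treatment. *)
Lemma Rintegral_elements f : mu.-integrable `]a, b[ (EFin \o f) ->
  \int[mu]_(x in `]a, b[) f x =
  \sum_(k < size s) \int[mu]_(x in element k) f x.
Proof.
move=> fi; rewrite (eq_bigr (fun k : 'I_(size s) =>
    prim a f (node k.+1) - prim a f (node k))); last first.
  by move=> k _; exact: Rintegral_element.
rewrite -(big_mkord xpredT (fun k => prim a f (node k.+1) - prim a f (node k))).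
rewrite telescope_sumr// node_size node0 Rintegral_oo_cc// /prim.
by rewrite [X in _ - X](_ : _ = 0) ?subr0// set_itv1 Rintegral_set1.
Qed.

Definition slope f k : R := (f (node k.+1) - f (node k)) / (node k.+1 - node k).

Lemma slope_mul f k : (k < size s)%N ->
  slope f k * (node k.+1 - node k) = f (node k.+1) - f (node k).
Proof. by move=> ks; rewrite divfK// subr_eq0 gt_eqF// node_ltS. Qed.

(** The derivative of the nodal interpolant of f, with value 0 at the nodes; [prim a (slopes f)] is
    the interpolant shifted by -f(a). A combination of indicators fits [test_dense_sum]. *)
Definition slopes f x : R :=
  \sum_(k < size s) slope f k * \1_(`]node k, node k.+1[%classic) x.

Lemma test_dense_slopes f : test_dense a b (slopes f).
Proof.
apply: (test_dense_sum hab) => i; apply: test_dense_indic.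
  exact/node_ge/ltnW.
exact: node_leb.
Qed.

Lemma L2on_slopes f : L2on mu E (slopes f).
Proof. by case: (test_dense_slopes f). Qed.

Lemma slopesE f k x : (k < size s)%N -> x \in `]node k, node k.+1[ ->
  slopes f x = slope f k.
Proof.
move=> ks xk; rewrite /slopes (bigD1 (Ordinal ks))//= indicE mem_set// mulr1.
rewrite big1 ?addr0// => i ik; rewrite indicE memNset ?mulr0// => /=.
move: xk; rewrite !in_itv/= => /andP[h1 h2] /andP[h3 h4].
have : (i != k :> nat) by [].
rewrite neq_ltn => /orP[ik'|ki].
  have := node_le (j := i.+1) (k := k); rewrite ik' (ltnW ks) => /(_ isT).
  by move=> h; have := lt_trans (lt_le_trans h4 h) h1; rewrite ltxx.
have := node_le (j := k.+1) (k := i); rewrite ki ltnW// => /(_ isT).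
by move=> h; have := lt_trans (lt_le_trans h2 h) h3; rewrite ltxx.
Qed.

Lemma prim_slopes_step f k x : (k < size s)%N -> element k x ->
  prim a (slopes f) x - prim a (slopes f) (node k) = slope f k * (x - node k).
Proof.
move=> ks; rewrite /Defs.element/= in_itv/= => /andP[kx xk].
have fi := L2on_integrable_cc (L2on_slopes f).
have xb : x <= b by rewrite (le_trans xk) ?node_leb.
have ak : a <= node k by exact: node_ge (ltnW ks).
have fx : mu.-integrable `[a, x] (EFin \o slopes f).
  by apply: integrableS fi => //; apply: subset_itvl; rewrite bnd_simp.
rewrite /prim Rintegral_itvB ?bnd_simp// -(Rintegral_cst_itv _ kx).
have fk : mu.-integrable `]node k, x[ (EFin \o slopes f).
  apply: integrableS fx => //; apply: subset_itv; rewrite bnd_simp//.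
rewrite -[RHS]Rintegral_oo_cc; last exact/L2on_integrable_oo/L2on_cst.
rewrite -Rintegral_itv_bndo_bndc//.
apply: eq_Rintegral => t; rewrite inE/= in_itv/= => /andP[kt tx].
by apply: slopesE => //; rewrite in_itv/= kt (lt_le_trans tx).
Qed.

Lemma prim_slopes_node f k : (k <= size s)%N ->
  prim a (slopes f) (node k) = f (node k) - f a.
Proof.
elim: k => [_|k ih ks].
  by rewrite node0 subrr /prim set_itv1 Rintegral_set1.
have lt := node_ltS ks.
have /prim_slopes_step -/(_ f ks) : element k (node k.+1).
  by rewrite /Defs.element/= in_itv/= lexx ltW.
rewrite (ih (ltnW ks)) /slope divfK ?subr_eq0 ?gt_eqF// => h.
by apply/eqP; rewrite -subr_eq0; apply/eqP; lra.
Qed.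

Lemma prim_slopes f k x : (k < size s)%N -> element k x ->
  prim a (slopes f) x = f (node k) - f a + slope f k * (x - node k).
Proof.
move=> ks kx; have h := prim_slopes_step f ks kx; have h' := prim_slopes_node f (ltnW ks).
by rewrite -h -h' addrC subrK.
Qed.

Lemma prim_slopes_continuous f : {within `[a, b], continuous (prim a (slopes f))}.
Proof.
apply: prim_continuous; first exact: ltW.
exact/L2on_integrable_cc/L2on_slopes.
Qed.

Lemma prim_slopes_a f : prim a (slopes f) a = 0.
Proof. by rewrite /prim set_itv1 Rintegral_set1. Qed.

Lemma prim_slopes_b f : prim a (slopes f) b = f b - f a.
Proof. by have := prim_slopes_node f (leqnn (size s)); rewrite node_size. Qed.

Lemma Vh_prim_slopes f : f b = f a -> Vh a b s (prim a (slopes f)).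
Proof.
move=> fab; split.
- exact: prim_slopes_continuous.
- move=> k ks; exists (slope f k), (f (node k) - f a - slope f k * node k) => x kx.
  by rewrite (prim_slopes f ks kx); ring.
- exact: prim_slopes_a.
- by rewrite prim_slopes_b fab subrr.
Qed.

(** A member of V_h is its own interpolant. *)
Lemma Vh_prim v x : Vh a b s v -> x \in `[a, b] -> v x = prim a (slopes v) x.
Proof.
move=> [_ aff va _] /mem_element[k ks kx].
rewrite (prim_slopes v ks kx) va subr0 /slope.
have [m [d H]] := aff k ks; have lt := node_ltS ks.
rewrite !H//; last 2 first.
- by rewrite /Defs.element/= in_itv/= lexx ltW.
- by rewrite /Defs.element/= in_itv/= lexx ltW.
field; by rewrite subr_eq0 gt_eqF.
Qed.

Lemma test_approx_ext u v g : L2on mu E v -> (forall x, x \in `]a, b[ -> u x = v x) ->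
  test_approx a b u g -> test_approx a b v g.
Proof.
move=> Lv uv [Lu Lg app]; split => // e e0.
have [phi [tphi h1 h2]] := app e e0; exists phi; split => //.
rewrite (@eq_Rintegral _ _ _ mu _ (fun x => (u x - phi x) ^+ 2))// => x.
by rewrite inE => /uv ->.
Qed.

(** The inclusion of V_h in H^1_0, together with an explicit weak derivative. *)
Lemma Vh_test_approx v : Vh a b s v -> test_approx a b v (slopes v).
Proof.
move=> hv; have [cv _ va vb] := hv.
apply: (@test_approx_ext (prim a (slopes v))).
- exact: within_continuous_L2on.
- move=> x; rewrite in_itv/= => /andP[ax xb]; apply/esym/Vh_prim => //.
  by rewrite in_itv/= !ltW.
- apply: test_dense_prim => //; first exact: test_dense_slopes.
  by rewrite prim_slopes_b va vb subrr.
Qed.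

End mesh.

(** * The sharp Poincare inequality *)

Section poincare.
Context (R : realType).
Notation mu := (@lebesgue_measure R).
Implicit Types (w dw : R -> R) (x c d k : R).

(* With g = cot (k x + const), which satisfies g' = - k (1 + g^2), one has
   w'^2 - k^2 w^2 = (w' - k g w)^2 + (k g w^2)'; the constant is chosen so that
   the argument of cot stays strictly inside (0, pi), which needs k (d - c) < pi. *)
Lemma poincare_subcritical w dw c d k : c < d ->
  (forall x, is_derive x 1 w (dw x)) -> continuous dw -> w c = 0 -> w d = 0 ->
  0 < k -> k * (d - c) < pi ->
  k ^+ 2 * \int[mu]_(x in `[c, d]) (w x ^+ 2) <= \int[mu]_(x in `[c, d]) (dw x ^+ 2).
Proof.
move=> cd Dw cdw wc wd k0 kpi.
have cw : continuous w by apply: derivable1_continuous => x; case: (Dw x).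
(* Half of the slack: [theta] runs from e at c to pi - e at d. *)
pose e : R := (pi - k * (d - c)) / 2.
have e0 : 0 < e by rewrite divr_gt0// subr_gt0.
pose theta x : R := k * x + (e - k * c).
have Dtheta x : is_derive x 1 theta k.
  rewrite /theta; apply: is_derive_eq; rewrite addr0 /GRing.scale/=; ring.
pose F x : R := k * (cos (theta x) * (sin (theta x))^-1 * (w x * w x)).
pose r x : R := dw x - k * (cos (theta x) * (sin (theta x))^-1) * w x.
pose f x : R := dw x * dw x - k ^+ 2 * (w x * w x) - r x * r x.
have sin0 x : c <= x <= d -> sin (theta x) != 0.
  move=> /andP[cx xd]; rewrite gt_eqF// sin_gt0_pi//.
  have h1 : 0 <= k * (x - c) by rewrite mulr_ge0 ?subr_ge0// ltW.
  have h2 : k * (x - c) <= k * (d - c) by rewrite ler_wpM2l ?lerB// ltW.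
  rewrite /theta; apply/andP; split; first by lra.
  by rewrite /e; lra.
have ctheta : continuous theta by apply: derivable1_continuous => x; case: (Dtheta x).
have cr x : c <= x <= d -> {for x, continuous r}.
  move=> xcd; rewrite /r; apply: cvgB; first exact: cdw.
  apply: cvgM; last exact: cw.
  apply: cvgM; first exact: cvg_cst.
  apply: cvgM.
    apply: continuous_comp; [exact: ctheta|exact: continuous_cos].
  apply: cvgV; first exact: sin0.
  apply: continuous_comp; [exact: ctheta|exact: continuous_sin].
have cf x : c <= x <= d -> {for x, continuous f}.
  move=> xcd; have crx := cr x xcd.
  rewrite /f; apply: cvgB; last by apply: cvgM.
  apply: cvgB; first by apply: cvgM; exact: cdw.
  by apply: cvgM; [exact: cvg_cst|apply: cvgM; exact: cw].
have cwf : {within `[c, d], continuous f}.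
  by apply: continuous_in_subspaceT => x; rewrite inE/= in_itv/=; exact: cf.
have DF x : c <= x <= d -> is_derive x 1 F (f x).
  move=> xcd; have s0 := sin0 x xcd; have dw1 := Dw x; have dt := Dtheta x.
  have ds : is_derive x 1 (fun y => sin (theta y)) (cos (theta x) * k).
    exact: (@is_derive1_comp _ sin theta).
  have dc : is_derive x 1 (fun y => cos (theta y)) (- sin (theta x) * k).
    exact: (@is_derive1_comp _ cos theta).
  have dv := is_deriveV s0 ds.
  have dg := is_deriveM dc dv.
  have dww := is_deriveM dw1 dw1.
  have H : is_derive x 1 F (k * (cos (theta x) * (sin (theta x))^-1 *
      (w x * dw x + w x * dw x) + (w x * w x) *
      (cos (theta x) * (- sin (theta x) ^- 2 * (cos (theta x) * k)) +
       (sin (theta x))^-1 * (- sin (theta x) * k)))).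
    exact: (is_deriveZ k (is_deriveM dg dww)).
  by apply: (is_derive_eq H); rewrite /f /r /GRing.scale/=; field.
have FTC : \int[mu]_(x in `[c, d]) f x = 0.
  rewrite /Rintegral (@continuous_FTC2 _ f F)//=.
  - by rewrite /F wc wd !mulr0 subr0.
  - split.
    + move=> x; rewrite in_itv/= => /andP[cx xd].
      by have [] := DF x; rewrite ?ltW.
    + apply: cvg_at_right_filter; apply: differentiable_continuous.
      by apply/derivable1_diffP; have [] := DF c; rewrite ?lexx ?ltW.
    + apply: cvg_at_left_filter; apply: differentiable_continuous.
      by apply/derivable1_diffP; have [] := DF d; rewrite ?lexx ?ltW.
  - move=> x; rewrite in_itv/= => /andP[cx xd]; rewrite derive1E.
    by have [] := DF x; rewrite ?ltW.
have int (g : R -> R) : (forall x, c <= x <= d -> {for x, continuous g}) ->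
    mu.-integrable `[c, d] (EFin \o (fun x => g x * g x)).
  move=> cg; apply: continuous_compact_integrable; first exact: segment_compact.
  apply: continuous_in_subspaceT => x; rewrite inE/= in_itv/= => xcd.
  by apply: cvgM; exact: cg.
have i1 : mu.-integrable `[c, d] (EFin \o (fun x => dw x * dw x)).
  by apply: int => x _; exact: cdw.
have i2 : mu.-integrable `[c, d] (EFin \o (fun x => w x * w x)).
  by apply: int => x _; exact: cw.
have i3 : mu.-integrable `[c, d] (EFin \o (fun x => r x * r x)) by exact: int.
have i4 : mu.-integrable `[c, d] (EFin \o (fun x => k ^+ 2 * (w x * w x))).
  by have := integrableZl (measurable_itvR _) (k ^+ 2) i2.
have i5 : mu.-integrable `[c, d] (EFin \o (fun x => dw x * dw x - k ^+ 2 * (w x * w x))).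
  by have := integrableB (measurable_itvR _) i1 i4.
move: FTC; rewrite /f RintegralB// RintegralB// RintegralZl//.
have : 0 <= \int[mu]_(x in `[c, d]) (r x * r x).
  by apply: Rintegral_ge0 => x _; rewrite -expr2 sqr_ge0.
lra.
Qed.

(** The critical k = pi / (d - c) would bring the poles of cot to the end points, so it is reached
    as a limit of k = K - e. *)
Lemma poincare_sharp w dw c d : c < d ->
  (forall x, is_derive x 1 w (dw x)) -> continuous dw -> w c = 0 -> w d = 0 ->
  \int[mu]_(x in `[c, d]) (w x ^+ 2) <=
  ((d - c) / pi) ^+ 2 * \int[mu]_(x in `[c, d]) (dw x ^+ 2).
Proof.
move=> cd Dw cdw wc wd.
have h0 : 0 < d - c by rewrite subr_gt0.
have K0 : 0 < pi / (d - c) :> R by rewrite divr_gt0// pi_gt0.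
have H k := @poincare_subcritical w dw c d k cd Dw cdw wc wd.
have W0 := Rintegral_sqr_ge0 mu `[c, d] w.
have D0 := Rintegral_sqr_ge0 mu `[c, d] dw.
set W := \int[mu]_(x in _) (w x ^+ 2) in H W0 *.
set D := \int[mu]_(x in _) (dw x ^+ 2) in H D0 *.
rewrite -[(d - c) / pi]invf_div exprVn mulrC ler_pdivlMr ?exprn_gt0//.
set K := pi / (d - c) in K0 *.
rewrite -subr_le0; apply: (@le0_eps _ _ (2 * K * W)) => e e0.
have KW0 : 0 <= K * W by rewrite mulr_ge0// ltW.
(* For e >= K the claim is immediate, as K^2 W <= K W e. *)
have [eK|Ke] := ltP e K; last first.
  have : 0 <= K * W * (e - K) by rewrite mulr_ge0 ?subr_ge0.
  have : 0 <= K * W * e by rewrite mulr_ge0// ltW.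
  nra.
have := H (K - e); rewrite subr_gt0 eK => /(_ isT).
have -> : (K - e) * (d - c) < pi.
  by rewrite mulrBl divfK ?gt_eqF// ltrBlDr ltrDl mulr_gt0.
move=> /(_ isT) => h.
have : 0 <= e ^+ 2 * W by rewrite mulr_ge0 ?sqr_ge0.
by nra.
Qed.

End poincare.

(** * The a posteriori estimate *)

Section weighted.
Context d (T : measurableType d) (R : realType).
Context (mu : {measure set T -> \bar R}).

Lemma measurable_fun_inv (A : set T) (k : T -> R) : measurable_fun A k ->
  measurable_fun A (fun x => (k x)^-1).
Proof.
move=> mk; rewrite (_ : (fun x => (k x)^-1) =
    (fun x => k x * ((k x ^+ 2) `^ (-1)))); last first.
  apply/funext => x; rewrite powR_inv1 ?sqr_ge0// expr2 invfM mulrA.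
  have [->|k0] := eqVneq (k x) 0; first by rewrite invr0 !mul0r.
  by rewrite divff// mul1r.
apply: measurable_funM => //.
apply: (measurableT_comp (measurable_powR (-1))).
exact: measurable_funX.
Qed.

(** The discriminant argument applied to 1/k + 2 t g + t^2 k g^2 = (1 + t k g)^2 / k, which avoids
    the square root of k. *)
Lemma cauchy_schwarz_weighted (A : set T) (k g : T -> R) : measurable A ->
  mu.-integrable A (EFin \o (fun x => (k x)^-1)) ->
  mu.-integrable A (EFin \o g) ->
  mu.-integrable A (EFin \o (fun x => k x * g x ^+ 2)) ->
  {ae mu, forall x, A x -> 0 < k x} ->
  (\int[mu]_(x in A) g x) ^+ 2 <=
  \int[mu]_(x in A) (k x)^-1 * \int[mu]_(x in A) (k x * g x ^+ 2).
Proof.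
move=> mA i1 i2 i3 k0.
have m3 : measurable_fun A (fun x => k x * g x ^+ 2).
  by apply/measurable_EFinP; exact: measurable_int i3.
apply: sqr_le_mul_of_quadratic_ge0; last first.
  apply: ae_Rintegral_ge0 => //; apply: filterS k0 => x /= H Ax.
  by rewrite mulr_ge0 ?sqr_ge0// ltW// H.
move=> t.
have j2 : mu.-integrable A (EFin \o (fun x => 2 * t * g x)).
  by have := integrableZl mA (2 * t) i2.
have j3 : mu.-integrable A (EFin \o (fun x => t ^+ 2 * (k x * g x ^+ 2))).
  by have := integrableZl mA (t ^+ 2) i3.
have j4 : mu.-integrable A (EFin \o (fun x => (k x)^-1 + 2 * t * g x)).
  by have := integrableD mA i1 j2.
rewrite -(RintegralZl _ mA i2) -(RintegralZl _ mA i3) -(RintegralD mA i1 j2).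
rewrite -(RintegralD mA j4 j3); apply: ae_Rintegral_ge0 => //.
  have j5 : mu.-integrable A
      (EFin \o (fun x => (k x)^-1 + 2 * t * g x + t ^+ 2 * (k x * g x ^+ 2))).
    by have := integrableD mA j4 j3.
  by apply/measurable_EFinP; exact: measurable_int j5.
apply: filterS k0 => x /= H Ax; have kx := H Ax.
rewrite (_ : _ + _ = (k x)^-1 * (1 + t * (k x * g x)) ^+ 2); last first.
  by field; rewrite gt_eqF.
by rewrite mulr_ge0 ?sqr_ge0// invr_ge0 ltW.
Qed.

End weighted.

(** * Residual, Galerkin error and point values *)

Section galerkin.
Context (R : realType) (a b : R) (hab : a < b).
Context (s : seq R) (hs : itv_partition a b s).
Context (kappa c f : R -> R) (kappaK : 'I_(size s) -> R).
Context (hkappa : Lp `]a, b[ +oo%E kappa).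
Context (hkappaK : forall k : 'I_(size s), 0 < kappaK k /\
     {ae @lebesgue_measure R,
       forall x, element a b s k x -> kappa x = kappaK k}).
Context (hc : Lp `]a, b[ +oo%E c).
Context (hc0 : {ae @lebesgue_measure R, forall x, x \in `]a, b[ -> 0 <= c x}).
Context (hf : Lp `]a, b[ 2%:E f).
Notation mu := (@lebesgue_measure R).
Notation E := (`]a, b[%classic : set (measurableTypeR R)).
Notation node := (node a b s).
Notation element := (element a b s).
Notation slope := (slope a b s).
Notation slopes := (slopes a b s).
Implicit Types (u v w g h phi psi : R -> R) (x : R).

Let mE : measurable E := measurable_itvR _.

Let mkappa : measurable_fun E kappa.
Proof. by have [] := Lfuny_restrict_bounded mE hkappa. Qed.

Let mc : measurable_fun E c.
Proof. by have [] := Lfuny_restrict_bounded mE hc. Qed.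

Let Lf : L2on mu E f.
Proof. exact/Lp2P. Qed.

Lemma L2on_kappa g : L2on mu E g -> L2on mu E (fun x => kappa x * g x).
Proof.
have [_ [M HM]] := Lfuny_restrict_bounded mE hkappa.
exact: L2on_bounded_mul HM.
Qed.

Lemma L2on_c g : L2on mu E g -> L2on mu E (fun x => c x * g x).
Proof.
have [_ [M HM]] := Lfuny_restrict_bounded mE hc.
exact: L2on_bounded_mul HM.
Qed.

Lemma ae_kappa : {ae mu, forall x, x \in `[a, b] ->
  exists k : 'I_(size s), kappa x = kappaK k}.
Proof.
have H : {ae mu, forall x, forall n (h : (n < size s)%N),
    element n x -> kappa x = kappaK (Ordinal h)}.
  (* The countable quantifier ranges over all naturals; indices beyond the mesh are vacuous. *)
  apply: ae_foralln => n; have [h|h] : (n < size s)%N \/ (size s <= n)%N.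
      by case: ltnP => _; [left|right].
    2: by apply: aeW => x h'; move: (leq_trans h' h); rewrite ltnn.
  apply: ae_imp (hkappaK (Ordinal h)).2 => x H h' nx.
  by rewrite (H nx); congr kappaK; exact/val_inj.
apply: ae_imp H => x H xab.
have [k ks kx] := mem_element hs hab xab.
by exists (Ordinal ks); exact: H.
Qed.

Lemma ae_kappa_gt0 : {ae mu, forall x, x \in `[a, b] -> 0 < kappa x}.
Proof.
apply: ae_imp ae_kappa => x H /H[k ->].
exact: (hkappaK k).1.
Qed.

Lemma integrable_kappaV : mu.-integrable `[a, b] (EFin \o (fun x => (kappa x)^-1)).
Proof.
apply/integrable_oo_cc/L2on_integrable_oo.
(* The sum of these positive inverses bounds each of them. *)
apply: (@L2on_bounded _ _ _ _ _ (\sum_k (kappaK k)^-1)) => //.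
- exact: lebesgue_oo_fin.
- exact: measurable_fun_inv.
apply: ae_imp ae_kappa => x H /=; rewrite in_itv/= => /andP[ax xb].
have [|k ->] := H; first by rewrite in_itv/= !ltW.
have K0 i : 0 < (kappaK i)^-1 by rewrite invr_gt0 (hkappaK i).1.
rewrite gtr0_norm// (bigD1 k)//= lerDl.
by apply: sumr_ge0 => i _; exact: ltW.
Qed.

(** [aform] with the derivatives as explicit arguments, so that bilinear computations bypass the
    choice [wderiv]; [aformE] is the bridge. *)
Definition form u g v h : R :=
  \int[mu]_(x in `]a, b[) (kappa x * g x * h x + c x * u x * v x).

Lemma form_integrable u g v h : L2on mu E u -> L2on mu E g -> L2on mu E v ->
  L2on mu E h ->
  mu.-integrable E (EFin \o (fun x => kappa x * g x * h x + c x * u x * v x)).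
Proof.
move=> Lu Lg Lv Lh.
have i1 := L2on_mul_integrable mE (L2on_kappa Lg) Lh.
have i2 := L2on_mul_integrable mE (L2on_c Lu) Lv.
by have := integrableD mE i1 i2.
Qed.

Lemma aformE u g v h : test_approx a b u g -> test_approx a b v h ->
  aform a b kappa c u v = form u g v h.
Proof.
move=> ug vh; have [L1 e1] := test_approx_wderiv hab ug.
have [L2 e2] := test_approx_wderiv hab vh.
have [Lu Lg _] := ug; have [Lv Lh _] := vh.
apply: ae_eq_Rintegral => //.
- apply/measurable_EFinP; apply: measurable_int.
  exact: form_integrable Lu L1 Lv L2.
- apply/measurable_EFinP; apply: measurable_int.
  exact: form_integrable Lu Lg Lv Lh.
- by apply: ae_imp2 e1 e2 => x h1 h2 Ex; rewrite h1// h2.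
Qed.

Lemma formBl u1 g1 u2 g2 v h : L2on mu E u1 -> L2on mu E g1 -> L2on mu E u2 ->
  L2on mu E g2 -> L2on mu E v -> L2on mu E h ->
  form (fun x => u1 x + -1 * u2 x) (fun x => g1 x + -1 * g2 x) v h =
  form u1 g1 v h - form u2 g2 v h.
Proof.
move=> Lu1 Lg1 Lu2 Lg2 Lv Lh; rewrite /form -RintegralB//; last 2 first.
- exact: form_integrable.
- exact: form_integrable.
by apply: eq_Rintegral => x _; ring.
Qed.

Lemma formC u g v h : form u g v h = form v h u g.
Proof. by apply: eq_Rintegral => x _; ring. Qed.

Lemma form_split u g v h : L2on mu E u -> L2on mu E g -> L2on mu E v ->
  L2on mu E h -> form u g v h =
  \int[mu]_(x in `]a, b[) (kappa x * g x * h x) +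
  \int[mu]_(x in `]a, b[) (c x * u x * v x).
Proof.
move=> Lu Lg Lv Lh; rewrite -RintegralD//.
- exact: L2on_mul_integrable (L2on_kappa Lg) Lh.
- exact: L2on_mul_integrable (L2on_c Lu) Lv.
Qed.

Lemma element_measurable k : measurable (element k : set (measurableTypeR R)).
Proof. exact: measurable_itvR. Qed.

Lemma L2on_element g k : L2on mu E g -> (k < size s)%N -> L2on mu (element k) g.
Proof.
move=> Lg ks; apply: L2on_sub (L2on_oo_cc Lg) => //; first exact: element_measurable.
exact: element_sub.
Qed.

Lemma test_function_slopes_node phi k : test_function a b phi ->
  (k <= size s)%N ->
  prim a (fun x => derive1 phi x - slopes phi x) (node k) = 0.
Proof.
move=> tphi ks; have sphi := test_function_smooth tphi.
have L1 := smooth_derive1_L2on a b sphi; have L2 := L2on_slopes hs hab phi.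
have := prim_linear (-1) (L2on_integrable_cc L1) (L2on_integrable_cc L2)
  (node_leb hs ks).
rewrite (_ : (fun t => _ + -1 * _) = (fun x => derive1 phi x - slopes phi x));
  last by apply/funext => x; rewrite mulN1r.
move=> ->; rewrite -(test_function_prim tphi (node_ge hs ks)).
rewrite (prim_slopes_node hs hab phi ks) (test_function_out tphi (x := a)).
  by rewrite subr0 mulN1r subrr.
by rewrite in_itv/= ltxx.
Qed.

(* On each element kappa and the slopes of u are constant, so that only the
   mean of the derivative of the interpolation error matters, and it is 0. *)
Lemma kappa_slopes_orthogonal u phi : test_function a b phi ->
  \int[mu]_(x in `]a, b[) (kappa x * slopes u x * (derive1 phi x - slopes phi x)) = 0.
Proof.
move=> tphi; have sphi := test_function_smooth tphi.
have L1 := smooth_derive1_L2on a b sphi.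
have L2 := L2on_slopes hs hab u; have L3 := L2on_slopes hs hab phi.
have L4 := L2onB mE L1 L3.
have i0 : mu.-integrable `]a, b[ (EFin \o
    (fun x => kappa x * slopes u x * (derive1 phi x - slopes phi x))).
  exact (L2on_mul_integrable mE (L2on_kappa L2) L4).
rewrite (Rintegral_elements hs)// big1// => k _.
have ks := ltn_ord k.
have sub := element_sub_oo hs ks.
have iw : mu.-integrable `]node k, node k.+1[ (EFin \o
    (fun x => derive1 phi x - slopes phi x)).
  exact: integrableS (L2on_integrable_oo L4).
have i0k : mu.-integrable `]node k, node k.+1[ (EFin \o
    (fun x => kappa x * slopes u x * (derive1 phi x - slopes phi x))).
  exact: integrableS i0.
(* The open element, since [slopes u] is constant only there. *)
rewrite -Rintegral_oo_cc//.
rewrite (@ae_eq_Rintegral _ _ _ mu `]node k, node k.+1[ _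
  (fun x => kappaK k * slope u k * (derive1 phi x - slopes phi x)))//; last 3 first.
- by apply/measurable_EFinP; exact: measurable_int i0k.
- have i1 := integrableZl (measurable_itvR _) (kappaK k * slope u k) iw.
  by apply/measurable_EFinP; exact: measurable_int i1.
- apply: ae_imp (hkappaK k).2 => x H /=; rewrite in_itv/= => /andP[h1 h2].
  rewrite H; last by rewrite /Defs.element/= in_itv/= !ltW.
  by rewrite (slopesE hs u ks)// in_itv/= h1.
rewrite RintegralZl// Rintegral_oo_cc//.
have := Rintegral_element hs (L2on_integrable_oo L4) ks.
have h1 := test_function_slopes_node tphi ks.
have h2 := test_function_slopes_node tphi (ltnW ks).
by rewrite h1 h2 subrr => h; rewrite [X in _ * X]h mulr0.
Qed.

Lemma integrable_element g k : mu.-integrable `]a, b[ (EFin \o g) ->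
  (k < size s)%N -> mu.-integrable (element k) (EFin \o g).
Proof.
move=> gi ks; apply: integrableS (integrable_oo_cc gi) => //.
  exact: element_measurable.
exact: element_sub.
Qed.

Lemma Rintegral_kappa_element g (k : 'I_(size s)) : L2on mu E g ->
  \int[mu]_(x in element k) (kappa x * g x ^+ 2) =
  kappaK k * \int[mu]_(x in element k) (g x ^+ 2).
Proof.
move=> Lg; have ks := ltn_ord k.
have i1 : mu.-integrable `]a, b[ (EFin \o (fun x => kappa x * g x ^+ 2)).
  have := L2on_mul_integrable mE (L2on_kappa Lg) Lg.
  by apply: eq_integrable => // x _ /=; rewrite expr2 mulrA.
have i2 := integrable_element i1 ks.
have [_ i3] := L2on_element Lg ks.
rewrite -RintegralZl//; last exact: element_measurable.
apply: ae_eq_Rintegral => //; first exact: element_measurable.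
- by apply/measurable_EFinP; exact: measurable_int i2.
- have i4 := integrableZl (element_measurable k) (kappaK k) i3.
  by apply/measurable_EFinP; exact: measurable_int i4.
- by apply: ae_imp (hkappaK k).2 => x H xk; rewrite H.
Qed.

(** After Poincare, the derivative of the error is phi' minus its mean m on the element, and
    subtracting the mean does not increase the L^2 norm. *)
Lemma interpolation_error_element phi k : test_function a b phi ->
  (k < size s)%N ->
  \int[mu]_(x in element k) ((phi x - prim a (slopes phi) x) ^+ 2) <=
  ((node k.+1 - node k) / pi) ^+ 2 *
  \int[mu]_(x in element k) (derive1 phi x ^+ 2).
Proof.
move=> tphi ks; have sphi := test_function_smooth tphi.
have phia : phi a = 0 by rewrite (test_function_out tphi)// in_itv/= ltxx.
have lt := node_ltS hs ks.
pose m := slope phi k.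
have mh : m * (node k.+1 - node k) = phi (node k.+1) - phi (node k).
  exact: slope_mul.
(* The error on this element, continued affinely to the whole line to be differentiable at both
   nodes as well. *)
pose w x := phi x + (- m * x + (m * node k - phi (node k))).
have Dw x : is_derive x 1 w (derive1 phi x + - m).
  have d1 := smooth_is_derive x sphi.
  have d2 : is_derive x 1 (fun y : R => - m * y + (m * node k - phi (node k))) (- m).
    by apply: is_derive_eq; rewrite addr0 /GRing.scale/=; ring.
  exact: is_deriveD.
have wE x : element k x -> phi x - prim a (slopes phi) x = w x.
  by move=> xk; rewrite (prim_slopes hs hab phi ks xk) phia /w -/m; ring.
rewrite (@eq_Rintegral _ _ _ mu _ (fun x => w x ^+ 2)); last first.
  by move=> x; rewrite inE => xk; rewrite wE.
have cd := smooth_continuous (smooth_derive1 sphi).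
apply: le_trans (poincare_sharp lt Dw _ _ _) _.
- by move=> x; apply: cvgD; [exact: cd|exact: cvg_cst].
- by rewrite /w; ring.
- by rewrite /w; lra.
apply: ler_wpM2l; first exact: sqr_ge0.
have L1 := smooth_derive1_L2on a b sphi.
have Lk := L2on_element L1 ks.
have L0 : L2on mu (element k) (fun=> 1) by exact: L2on_oo_cc (L2on_cst _ _ 1).
have := Rintegral_sqrD (- m) (element_measurable k) Lk L0.
rewrite (@eq_Rintegral _ _ _ mu _ (fun x => (derive1 phi x + - m) ^+ 2)
  (fun x => (derive1 phi x + - m * 1) ^+ 2)); last first.
  by move=> x _; rewrite mulr1.
move=> ->.
rewrite (@eq_Rintegral _ _ _ mu _ (derive1 phi)
  (fun x => derive1 phi x * 1)); last by move=> x _; rewrite mulr1.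
rewrite (@eq_Rintegral _ _ _ mu _ (fun=> 1) (fun=> 1 ^+ 2)); last first.
  by move=> x _; rewrite expr1n.
have -> : \int[mu]_(x in element k) 1 = node k.+1 - node k.
  by rewrite Rintegral_cst_itv ?mul1r// ltW.
rewrite (Rintegral_element hs (L2on_integrable_oo L1) ks).
rewrite -(test_function_prim tphi (node_ge hs ks)).
rewrite -(test_function_prim tphi (node_ge hs (ltnW ks))) -mh.
rewrite -addrA gerDl.
have : 0 <= m ^+ 2 * (node k.+1 - node k) by rewrite mulr_ge0 ?sqr_ge0 ?subr_ge0 ?ltW.
nra.
Qed.

Lemma eta_elt_sqr v (k : 'I_(size s)) :
  eta_elt a b kappaK c f v k ^+ 2 =
  (node k.+1 - node k) ^+ 2 / (pi ^+ 2 * kappaK k) *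
  \int[mu]_(x in element k) ((f x - c x * v x) ^+ 2).
Proof.
rewrite /eta_elt exprMn L2norm_sqr; congr (_ * _).
by rewrite expr_div_n exprMn sqr_sqrtr// ltW// (hkappaK k).1.
Qed.

Lemma eta_sqr v : eta a b kappaK c f v ^+ 2 =
  \sum_(k < size s) eta_elt a b kappaK c f v k ^+ 2.
Proof. by rewrite /eta sqr_sqrtr// sumr_ge0// => k _; exact: sqr_ge0. Qed.

Lemma residual_element v phi (k : 'I_(size s)) : L2on mu E v ->
  test_function a b phi ->
  2 * \int[mu]_(x in element k)
        ((f x - c x * v x) * (phi x - prim a (slopes phi) x)) <=
  eta_elt a b kappaK c f v k ^+ 2 +
  kappaK k * \int[mu]_(x in element k) (derive1 phi x ^+ 2).
Proof.
move=> Lv tphi; have ks := ltn_ord k; have sphi := test_function_smooth tphi.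
have Lr := L2on_element (L2onB mE Lf (L2on_c Lv)) ks.
have Lw := L2on_element (L2onB mE (smooth_L2on a b sphi)
  (L2on_prim hab (L2on_slopes hs hab phi))) ks.
have K0 := (hkappaK k).1.
have h0 : 0 < node k.+1 - node k by rewrite subr_gt0 (node_ltS hs).
have pi0 : 0 < pi :> R := pi_gt0 R.
have := interpolation_error_element tphi ks.
rewrite eta_elt_sqr.
set h := node k.+1 - node k in h0 *.
(* The Young weight in 2 Y <= t X + Z / t: t X is the squared element estimator, and Poincare turns
   Z / t into at most [kappaK k * Q]. *)
pose t := h ^+ 2 / (pi ^+ 2 * kappaK k).
have t0 : 0 < t by rewrite divr_gt0 ?exprn_gt0// mulr_gt0// exprn_gt0.
have := Rintegral_sqr_ge0 mu (element k)
  (fun x => f x - c x * v x + - t^-1 * (phi x - prim a (slopes phi) x)).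
rewrite (Rintegral_sqrD (- t^-1) (element_measurable k) Lr Lw) -/t.
set X := \int[mu]_(x in _) (_ ^+ 2); set Y := \int[mu]_(x in _) (_ * _).
set Z := \int[mu]_(x in _) (_ ^+ 2); set Q := \int[mu]_(x in _) (_ ^+ 2).
move=> H1 H2.
have H3 : 0 <= t * X - 2 * Y + t^-1 * Z.
  have : 0 <= t * (X + 2 * - t^-1 * Y + (- t^-1) ^+ 2 * Z).
    by rewrite mulr_ge0// ltW.
  rewrite [X in 0 <= X -> _](_ : _ = t * X - 2 * Y + t^-1 * Z)//.
  by field; rewrite gt_eqF.
have H4 : t^-1 * Z <= kappaK k * Q.
  have -> : kappaK k * Q = t^-1 * ((h / pi) ^+ 2 * Q).
    have aux (K l p q : R) : K != 0 -> l != 0 -> p != 0 ->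
        K * q = (l ^+ 2 / (p ^+ 2 * K))^-1 * ((l / p) ^+ 2 * q).
      by move=> *; field; apply/and3P.
    by apply: aux; rewrite gt_eqF.
  by rewrite ler_pM2l// invr_gt0.
lra.
Qed.

Lemma residual_test_le v phi : L2on mu E v -> test_function a b phi ->
  2 * \int[mu]_(x in `]a, b[)
        ((f x - c x * v x) * (phi x - prim a (slopes phi) x)) <=
  eta a b kappaK c f v ^+ 2 +
  \int[mu]_(x in `]a, b[) (kappa x * derive1 phi x ^+ 2).
Proof.
move=> Lv tphi; have sphi := test_function_smooth tphi.
have L1 := smooth_derive1_L2on a b sphi.
have i1 := L2on_mul_integrable mE (L2onB mE Lf (L2on_c Lv))
  (L2onB mE (smooth_L2on a b sphi) (L2on_prim hab (L2on_slopes hs hab phi))).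
have i2 : mu.-integrable `]a, b[ (EFin \o (fun x => kappa x * derive1 phi x ^+ 2)).
  have := L2on_mul_integrable mE (L2on_kappa L1) L1.
  by apply: eq_integrable => // x _ /=; rewrite expr2 mulrA.
rewrite (Rintegral_elements hs i1) (Rintegral_elements hs i2) eta_sqr.
rewrite mulr_sumr -big_split/=; apply: ler_sum => k _.
rewrite Rintegral_kappa_element//; exact: residual_element.
Qed.

Lemma loadB phi psi : L2on mu E phi -> L2on mu E psi ->
  load a b f phi - load a b f psi =
  \int[mu]_(x in `]a, b[) (f x * (phi x - psi x)).
Proof.
move=> L1 L2; rewrite -RintegralB//; try exact: L2on_mul_integrable.
by apply: eq_Rintegral => x _; rewrite mulrBr.
Qed.

Lemma galerkin_error_test_le u g v phi : test_approx a b u g ->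
  (forall w, H10 a b w -> aform a b kappa c u w = load a b f w) ->
  Vh a b s v ->
  (forall w, Vh a b s w -> aform a b kappa c v w = load a b f w) ->
  test_function a b phi ->
  2 * form (fun x => u x + -1 * v x) (fun x => g x + -1 * slopes v x)
        phi (derive1 phi) <=
  eta a b kappaK c f v ^+ 2 +
  \int[mu]_(x in `]a, b[) (kappa x * derive1 phi x ^+ 2).
Proof.
move=> ug hu hv hgal tphi; have [Lu Lg _] := ug.
have vg := Vh_test_approx hs hab hv; have [Lv Lvg _] := vg.
have pg := test_approx_test tphi; have [Lp Lpg _] := pg.
have phia : phi a = 0 by rewrite (test_function_out tphi)// in_itv/= ltxx.
have phib : phi b = 0 by rewrite (test_function_out tphi)// in_itv/= ltxx andbF.
pose I := prim a (slopes phi).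
have hI : Vh a b s I by apply: Vh_prim_slopes => //; rewrite phia phib.
have Ig : test_approx a b I (slopes phi).
  apply: (test_dense_prim hab); first exact: test_dense_slopes.
  by rewrite (prim_slopes_b hs hab) phia phib subrr.
have [LI LIg _] := Ig.
rewrite formBl//.
have -> : form u g phi (derive1 phi) = load a b f phi.
  by rewrite -(aformE ug pg) hu//; exact: (test_approx_H10 hab pg).
have E1 : form v (slopes v) I (slopes phi) = load a b f I.
  by rewrite -(aformE vg Ig) hgal.
(* The diffusion parts agree by [kappa_slopes_orthogonal]; only the term in c remains. *)
have E2 : form v (slopes v) phi (derive1 phi) - form v (slopes v) I (slopes phi) =
    \int[mu]_(x in `]a, b[) (c x * v x * (phi x - I x)).
  rewrite !form_split//.
  have j1 := L2on_mul_integrable mE (L2on_kappa Lvg) Lpg.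
  have j2 := L2on_mul_integrable mE (L2on_kappa Lvg) LIg.
  have j3 := L2on_mul_integrable mE (L2on_c Lv) Lp.
  have j4 := L2on_mul_integrable mE (L2on_c Lv) LI.
  have := kappa_slopes_orthogonal v tphi.
  under eq_Rintegral do rewrite mulrBr.
  rewrite RintegralB// => K0.
  under [RHS]eq_Rintegral do rewrite mulrBr.
  by rewrite RintegralB//; lra.
have -> : load a b f phi - form v (slopes v) phi (derive1 phi) =
    \int[mu]_(x in `]a, b[) ((f x - c x * v x) * (phi x - I x)).
  have -> : load a b f phi - form v (slopes v) phi (derive1 phi) =
     (load a b f phi - load a b f I) -
     (form v (slopes v) phi (derive1 phi) - form v (slopes v) I (slopes phi)).
    by rewrite E1; ring.
  rewrite E2 loadB// -RintegralB//.
  - by apply: eq_Rintegral => x _; ring.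
  - exact (L2on_mul_integrable mE Lf (L2onB mE Lp LI)).
  - exact (L2on_mul_integrable mE (L2on_c Lv) (L2onB mE Lp LI)).
exact: residual_test_le.
Qed.

Lemma kappa_sqr_le_form u g : L2on mu E u -> L2on mu E g ->
  \int[mu]_(x in `]a, b[) (kappa x * g x ^+ 2) <= form u g u g.
Proof.
move=> Lu Lg; rewrite form_split//.
rewrite (@eq_Rintegral _ _ _ mu _ (fun x => kappa x * g x * g x)); last first.
  by move=> x _; rewrite expr2 mulrA.
rewrite lerDl; apply: ae_Rintegral_ge0 => //.
  apply/measurable_EFinP; apply: measurable_int.
  exact (L2on_mul_integrable mE (L2on_c Lu) Lu).
apply: ae_imp hc0 => x /= H Ex; rewrite -mulrA -expr2 mulr_ge0 ?sqr_ge0//.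
exact: H.
Qed.

(** C is uniform in u and g, as [le0_eps] requires when phi varies with e. *)
Lemma form_bounded : exists C, forall u g e, L2on mu E u -> L2on mu E g ->
  \int[mu]_(x in `]a, b[) (u x ^+ 2) <= e ->
  \int[mu]_(x in `]a, b[) (g x ^+ 2) <= e -> form u g u g <= C * e.
Proof.
have [_ [M HM]] := Lfuny_restrict_bounded mE hkappa.
have [_ [N HN]] := Lfuny_restrict_bounded mE hc.
have B (k v : R -> R) (K e : R) : {ae mu, forall x, E x -> `|k x| <= K} ->
    mu.-integrable E (EFin \o (fun x => k x * v x * v x)) ->
    L2on mu E v -> \int[mu]_(x in `]a, b[) (v x ^+ 2) <= e ->
    \int[mu]_(x in `]a, b[) (k x * v x * v x) <= `|K| * e.
  move=> kK i1 [_ i2] ve.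
  have i3 : mu.-integrable E (EFin \o (fun x => K * v x ^+ 2)).
    by have := integrableZl mE K i2.
  apply: (@le_trans _ _ (\int[mu]_(x in `]a, b[) (K * v x ^+ 2))).
    apply: ae_le_Rintegral => //; apply: ae_imp kK => x H Ex.
    rewrite -mulrA -expr2 ler_wpM2r ?sqr_ge0//.
    exact: le_trans (ler_norm _) (H Ex).
  rewrite RintegralZl//; apply: (@le_trans _ _ (`|K| * \int[mu]_(x in `]a, b[) (v x ^+ 2))).
    by rewrite ler_wpM2r ?ler_norm// Rintegral_sqr_ge0.
  by rewrite ler_wpM2l.
exists (`|M| + `|N|) => u g e Lu Lg hu hg; rewrite form_split// mulrDl lerD//.
  apply: B => //; exact (L2on_mul_integrable mE (L2on_kappa Lg) Lg).
apply: B => //; exact (L2on_mul_integrable mE (L2on_c Lu) Lu).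
Qed.

(* Completing the square turns the bound on 2 A(e, phi) into
   A(e, e) <= eta^2 + A(e - phi, e - phi), where phi is arbitrarily close to e. *)
Lemma galerkin_error_le u g v : test_approx a b u g ->
  (forall w, H10 a b w -> aform a b kappa c u w = load a b f w) ->
  Vh a b s v ->
  (forall w, Vh a b s w -> aform a b kappa c v w = load a b f w) ->
  form (fun x => u x + -1 * v x) (fun x => g x + -1 * slopes v x)
       (fun x => u x + -1 * v x) (fun x => g x + -1 * slopes v x) <=
  eta a b kappaK c f v ^+ 2.
Proof.
move=> ug hu hv hgal.
have [Le Leg app] := test_approx_linear (-1) ug (Vh_test_approx hs hab hv).
have [C HC] := form_bounded.
rewrite -subr_le0; apply: (@le0_eps _ _ C) => d d0.
have [phi [tphi h1 h2]] := app d d0.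
have sphi := test_function_smooth tphi.
have L1 := smooth_L2on a b sphi; have L2 := smooth_derive1_L2on a b sphi.
have K1 := galerkin_error_test_le ug hu hv hgal tphi.
(* Replaces the weighted integral of phi'^2 by A(phi, phi), which is what completing the square
   needs. *)
have K2 := kappa_sqr_le_form L1 L2.
set e := (fun x => u x + -1 * v x) in Le h1 K1 *.
set eg := (fun x => g x + -1 * slopes v x) in Leg h2 K1 *.
have N1 (p q : R -> R) : (fun x => p x - q x) = (fun x => p x + -1 * q x).
  by apply/funext => x; rewrite mulN1r.
have := HC _ _ _ (L2onB mE Le L1) (L2onB mE Leg L2) h1 h2.
have L3 := L2onB mE Le L1; have L4 := L2onB mE Leg L2.
rewrite !N1 in L3 L4 *.
rewrite (formBl Le Leg L1 L2 L3 L4) (formC e) (formC phi).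
rewrite (formBl Le Leg L1 L2 Le Leg) (formBl Le Leg L1 L2 L1 L2).
rewrite (formC phi (derive1 phi) e eg).
by move: K1 K2; lra.
Qed.

Lemma sqr_le_sqrt_mul (P p q : R) : 0 <= p -> 0 <= q -> P ^+ 2 <= p * q ^+ 2 ->
  `|P| <= Num.sqrt p * q.
Proof.
move=> p0 q0 h; rewrite -sqrtr_sqr -[X in _ * X](ger0_norm q0) -sqrtr_sqr -sqrtrM//.
by rewrite ler_wsqrtr.
Qed.

Lemma prim_le_Cpt g (q x : R) : L2on mu E g -> 0 <= q ->
  \int[mu]_(t in `]a, b[) (kappa t * g t ^+ 2) <= q ^+ 2 ->
  prim a g b = 0 -> x \in `[a, b] -> `|prim a g x| <= Cpt a b kappa x * q.
Proof.
move=> Lg q0 hq pb; rewrite in_itv/= => /andP[ax xb].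
have i1 := L2on_integrable_cc Lg.
have i2 : mu.-integrable `]a, b[ (EFin \o (fun x => kappa x * g x ^+ 2)).
  have := L2on_mul_integrable mE (L2on_kappa Lg) Lg.
  by apply: eq_integrable => // t _ /=; rewrite expr2 mulrA.
have i3 := integrable_oo_cc i2.
rewrite (Rintegral_oo_cc i2) in hq.
have k0 := ae_kappa_gt0.
have nonneg (y z : R) : `[y, z] `<=` `[a, b] ->
    {ae mu, forall t, `[y, z]%classic t -> 0 < kappa t}.
  by move=> sub; apply: ae_imp k0 => t H yz; apply: H; exact: sub.
have mitv (y z : R) : measurable (`[y, z]%classic : set (measurableTypeR R)).
  exact: measurable_itvR.
have key (y z : R) : `[y, z] `<=` `[a, b] ->
    `|\int[mu]_(t in `[y, z]) g t| <=
    Num.sqrt (\int[mu]_(t in `[y, z]) (kappa t)^-1) * q.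
  move=> sub; have pos := nonneg y z sub.
  have j0 := integrableS (mitv a b) (mitv y z) sub integrable_kappaV.
  have j1 := integrableS (mitv a b) (mitv y z) sub i1.
  have j3 := integrableS (mitv a b) (mitv y z) sub i3.
  have p0 : 0 <= \int[mu]_(t in `[y, z]) (kappa t)^-1.
    apply: ae_Rintegral_ge0; first exact: mitv.
      by apply/measurable_EFinP; exact: measurable_int j0.
    by apply: ae_imp pos => t H yz; rewrite invr_ge0 ltW// H.
  apply: sqr_le_sqrt_mul => //.
  apply: le_trans (cauchy_schwarz_weighted (mitv y z) j0 j1 j3 pos) _.
  rewrite ler_wpM2l//; apply: le_trans hq.
  (* Monotonicity in the domain, as an almost-everywhere comparison of extensions by zero: kappa is
     positive only almost everywhere. *)
  rewrite [leLHS]Rintegral_mkcond [leRHS]Rintegral_mkcond.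
  apply: ae_le_Rintegral => //.
  - rewrite -restrict_EFin; apply/integrable_restrict => //=; rewrite setTI//.
  - rewrite -restrict_EFin; apply/integrable_restrict => //=; rewrite setTI//.
  apply: ae_imp k0 => t H _; rewrite !patchE.
  have [tyz|tyz] := boolP (t \in `[y, z]%classic).
    by rewrite mem_set//; apply: sub; rewrite inE in tyz.
  case: ifPn => // tab; rewrite mulr_ge0 ?sqr_ge0// ltW// H//.
  by rewrite inE in tab.
have h1 : `|prim a g x| <= Num.sqrt (\int[mu]_(t in `[a, x]) (kappa t)^-1) * q.
  by apply: key; apply: subset_itvl; rewrite bnd_simp.
have h2 : `|prim a g x| <= Num.sqrt (\int[mu]_(t in `[x, b]) (kappa t)^-1) * q.
  suff -> : prim a g x = - \int[mu]_(t in `[x, b]) g t.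
    by rewrite normrN; apply: key; apply: subset_itvr; rewrite bnd_simp.
  rewrite -Rintegral_itv_obnd_cbnd; last first.
    by apply: integrableS i1 => //; apply: subset_itv; rewrite bnd_simp.
  have := Rintegral_itvB (x := x) i1; rewrite !bnd_simp => /(_ ax xb) <-.
  by rewrite opprB -/(prim a g x) -/(prim a g b) pb subr0.
by rewrite /Cpt /Num.min; case: ifP.
Qed.

End galerkin.

(** * Linear algebra of the corrected value *)

Section linear_algebra.
Context (R : realType).

(** A kernel vector makes the quadratic form vanish; the transpose appears because [kermx] consists
    of row vectors. *)
Lemma spd_unitmx n (M : 'M[R]_n) : spd M -> M \in unitmx.
Proof.
move=> [_ pos]; rewrite -unitmx_tr -row_free_unit -kermx_eq0.
apply/eqP/row_matrixP => i; rewrite row0.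
have := sub_kermxP (row_sub i (kermx M^T)); set v := row _ _ => Hv.
apply/eqP; apply: contraT => v0.
have := pos v^T; rewrite trmx_eq0 v0 => /(_ isT).
have -> : (v^T)^T *m M *m v^T = 0.
  by rewrite -mulmxA -[M *m _]trmxK trmx_mul trmxK Hv trmx0 mulmx0.
by rewrite mxE ltxx.
Qed.

(** Moving the coefficients by Z d changes the residual by A Z d and the point value by l^T Z d; g
    converts the first change into the second, because the Hessian is symmetric. *)
Lemma correction_identity n p (Z : 'M[R]_(p, n)) (A : 'M[R]_(n, p)) (W : 'M[R]_n)
    (q d : 'cV[R]_n) (l : 'cV[R]_p) : W^T = W ->
  ((A *m Z)^T *m W *m (A *m Z)) *m q = Z^T *m l ->
  (W *m (A *m Z) *m q)^T *m (A *m Z *m d) = l^T *m Z *m d.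
Proof.
move=> Wt H.
have -> : l^T *m Z = (Z^T *m l)^T by rewrite trmx_mul trmxK.
by rewrite -H !trmx_mul Wt !trmxK !mulmxA.
Qed.

Lemma evalvecE (a b : R) (s : seq R) (x : R) (U : 'cV[R]_(size s).+1) :
  ((evalvec a b s x)^T *m U) 0 0 = Ih a b U x.
Proof.
by rewrite mxE; apply: eq_bigr => j _; rewrite !mxE mulrC.
Qed.

Lemma wnorm0 n (W : 'M[R]_n) : wnorm W 0 = 0.
Proof. by rewrite /wnorm mulmx0 mxE sqrtr0. Qed.

End linear_algebra.

Theorem theorem5p6 (R : realType) (a b : R) (hab : a < b)
  (* mesh *)
  (s : seq R) (hs : itv_partition a b s)
  (* data *)
  (kappa c f : R -> R) (kappaK : 'I_(size s) -> R)
  (hkappa : Lp `]a, b[ +oo%E kappa)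
  (hkappaK : forall k : 'I_(size s),
     0 < kappaK k /\
     {ae @lebesgue_measure R,
       forall x, element a b s k x -> kappa x = kappaK k})
  (hc : Lp `]a, b[ +oo%E c)
  (hc0 : {ae @lebesgue_measure R, forall x, x \in `]a, b[ -> 0 <= c x})
  (hf : Lp `]a, b[ 2%:E f)
  (* exact solution *)
  (ustar : R -> R) (hustar : H10 a b ustar)
  (hsol : forall v, H10 a b v -> aform a b kappa c ustar v = load a b f v)
  (* Galerkin solution *)
  (uFE : R -> R) (huFE : Vh a b s uFE)
  (hgal : forall v, Vh a b s v -> aform a b kappa c uFE v = load a b f v)
  (* algebraic form of the discrete problem *)
  (n : nat)
  (U0 : 'cV[R]_(size s).+1) (Z : 'M[R]_((size s).+1, n))
  (A : 'M[R]_(n, (size s).+1)) (bh : 'cV[R]_n)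
  (hZ : \rank Z = n)
  (hadm : forall U : 'cV[R]_(size s).+1,
     Vh a b s (Ih a b U) <-> exists y : 'cV[R]_n, U = U0 + Z *m y)
  (hred : forall y : 'cV[R]_n,
     (A *m Z) *m y = bh - A *m U0 <->
     forall v, Vh a b s v ->
       aform a b kappa c (Ih a b (U0 + Z *m y)) v = load a b f v)
  (hA : spd (A *m Z))
  (* coefficient vector of the Galerkin solution *)
  (UFE : 'cV[R]_(size s).+1) (yFE : 'cV[R]_n)
  (hUFE : UFE = U0 + Z *m yFE)
  (hIUFE : forall x, x \in `[a, b] -> Ih a b UFE x = uFE x)
  (* weight *)
  (W : 'M[R]_n) (hW : spd W) :
  let Ahat := A *m Z in
  let bhat := bh - A *m U0 in
  let Ustar := U0 + Z *m (invmx Ahat *m bhat) in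
  let Hhat := Ahat^T *m W *m Ahat in
  let etatr := eta a b kappaK c f uFE in
  let ustar_pt := cont_rep a b ustar in
  [/\ energy_norm a b kappa c (ustar \- uFE) <= etatr,
      forall x, x \in `[a, b] ->
        `|ustar_pt x - uFE x| <= Cpt a b kappa x * etatr,
      UFE = Ustar /\
      (forall x, x \in `[a, b] ->
        let Upi := UFE in
        let Th : R := 0 in
        let eps := Cpt a b kappa x * etatr in
        wnorm W (A *m Upi - bh) <= Th /\
        `|((evalvec a b s x)^T *m Upi) 0 0 - ustar_pt x| <= eps) &
      forall x, x \in `[a, b] ->
        forall (ytheta q : 'cV[R]_n),
        let l := evalvec a b s x in
        let Utheta := U0 + Z *m ytheta in
        let r := A *m Utheta - bh in
        Hhat *m q = Z^T *m l ->
        let g := W *m Ahat *m q in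
        let ccorr := (l^T *m Utheta) 0 0 - (g^T *m r) 0 0 in
        let eps := Cpt a b kappa x * etatr in
        ustar_pt x \in `[ccorr - eps, ccorr + eps] ].
Proof.
move=> Ahat bhat Ustar Hhat etatr ustar_pt.
have ug := H10_test_approx hab hustar.
have vg := Vh_test_approx hs hab huFE.
have eg := test_approx_linear (-1) ug vg.
have [Le Leg _] := eg.
have [Lu Lg _] := ug.
have [Lv Lvg _] := vg.
have eta0 : 0 <= etatr by exact: sqrtr_ge0.
have err := galerkin_error_le hab hs hkappa hkappaK hc hc0 hf ug hsol huFE hgal.
have energy : energy_norm a b kappa c (ustar \- uFE) <= etatr.
  rewrite /energy_norm -(ger0_norm eta0) -sqrtr_sqr ler_wsqrtr//.
  apply: le_trans err; rewrite -(aformE hab hkappa hc eg eg).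
  rewrite (_ : (fun x => _ + _) = ustar \- uFE)//.
  by apply/funext => x /=; rewrite mulN1r.
have point x : x \in `[a, b] -> `|ustar_pt x - uFE x| <= Cpt a b kappa x * etatr.
  move=> xab; have xb : x <= b by move: xab; rewrite in_itv/= => /andP[].
  have [_ pb] := test_approx_prim hab eg.
  have -> : ustar_pt x - uFE x =
      prim a (fun t => wderiv a b ustar t + -1 * slopes a b s uFE t) x.
    rewrite (prim_linear (-1) (L2on_integrable_cc Lg) (L2on_integrable_cc Lvg) xb).
    by rewrite /ustar_pt (cont_rep_prim hab ug xab) (Vh_prim hs hab huFE xab) mulN1r.
  apply: (prim_le_Cpt hab hs hkappa hkappaK Leg eta0 _ pb xab).
  exact: le_trans (kappa_sqr_le_form hkappa hc hc0 Le Leg) err.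
have uA : Ahat \in unitmx by exact: spd_unitmx.
have yE : Ahat *m yFE = bhat.
  apply/hred => v hv; rewrite -hUFE -hgal//.
  have VI : Vh a b s (Ih a b UFE) by apply/hadm; exists yFE.
  have ig := Vh_test_approx hs hab VI.
  have wg := Vh_test_approx hs hab hv.
  have [Li Lig _] := ig.
  rewrite (aformE hab hkappa hc ig wg) (aformE hab hkappa hc vg wg).
  (* The two functions are known to agree on [a, b] only; [slopes] sees nothing but nodal values,
     all taken there. *)
  have -> : slopes a b s (Ih a b UFE) = slopes a b s uFE.
    apply/funext => x; apply: eq_bigr => k _; congr (_ * _).
    have ks := ltn_ord k.
    by rewrite /slope !hIUFE// in_itv/= !(node_ge hs, node_leb hs)// ltnW.
  apply: eq_Rintegral => x; rewrite inE/= in_itv/= => /andP[ax xb].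
  by rewrite hIUFE// in_itv/= !ltW.
have UE : UFE = Ustar by rewrite /Ustar -yE mulKmx.
have rFE : A *m UFE - bh = 0.
  rewrite hUFE mulmxDr mulmxA -/Ahat yE /bhat.
  by rewrite subrKC subrr.
split => //.
- split => // x xab /=; split; first by rewrite rFE wnorm0.
  by rewrite evalvecE hIUFE// distrC; exact: point.
- move=> x xab ytheta q l Utheta r Hq; cbv zeta.
  set g := W *m Ahat *m q; set ccorr := (l^T *m Utheta) 0 0 - (g^T *m r) 0 0; set eps := _ * etatr.
  have dE : Utheta = UFE + Z *m (ytheta - yFE).
    by rewrite /Utheta hUFE mulmxBr -addrA [Z *m yFE + _]addrC subrK.
  have rE : r = Ahat *m (ytheta - yFE).
    rewrite /r dE mulmxDr addrAC rFE add0r mulmxA//.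
  (* Both the point value and the residual deviate through the same d = [ytheta - yFE], and the
     correction removes it. *)
  have cE : ccorr = uFE x.
    rewrite /ccorr /g rE (correction_identity _ hW.1 Hq) dE mulmxDr mulmxA.
    rewrite [X in X - _ = _]mxE addrK /l evalvecE hIUFE//.
  have := point x xab; rewrite -cE -/eps ler_distl => /andP[h1 h2].
  by rewrite in_itv/= h1.
Qed.
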